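(* The problems Isometric Path Cover with Terminals and Strong Geodetic Set with Terminals are fixed-parameter tractable when parameterized by the number of terminals; that is, each can be solved in time $f(k)\cdot |I|^{O(1)}$ for some computable function $f$, where $|I|$ is the input size and $k$ is the number of terminal pairs (for Isometric Path Cover with Terminals) or the number of terminals (for Strong Geodetic Set with Terminals).
   Context: All graphs are finite, undirected and unweighted. Isometric Path Cover with Terminals: given a graph $G$ and $k$ pairs of vertices $(s_1,t_1),\dots,(s_k,t_k)$, decide whether there exist $k$ paths $P_1,\dots,P_k$, where $P_i$ is a shortest $s_i$-$t_i$ path in $G$, such that every vertex of $G$ belongs to at least one $P_i$. Strong Geodetic Set with Terminals: given a graph $G$ and a set of $k$ vertices (terminals), decide whether there exist $\binom{k}{2}$ shortest paths, each joining a distinct pair of terminals, such that every vertex of $G$ belongs to at least one of them. *)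

(* Defs.v *)
From mathcomp Require Import all_boot.

Set Implicit Arguments.
Unset Strict Implicit.
Unset Printing Implicit Defensive.

(* Model of computation: the WHILE language over binary trees of N. D. Jones,
   "Computability and Complexity from a Programming Perspective" (MIT Press,
   1997), with its usual time measure, in which every elementary operation
   (nil, cons, hd, tl, variable access, assignment, test for nil) has unit
   cost.  Trees can be tested only through their root, so that sharing gives a
   faithful implementation: this time measure is polynomially related to the
   one of Turing machines.  Each program mentions finitely many variables. *)

Inductive tree : Type := Leaf | Node of tree & tree.

Fixpoint tsize (t : tree) : nat :=
  if t is Node a b then (tsize a + tsize b).+1 else 1.

Definition thd (t : tree) : tree := if t is Node a _ then a else Leaf.
Definition ttl (t : tree) : tree := if t is Node _ b then b else Leaf.

Inductive expr : Type :=
  | Var of nat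
  | Nil
  | Cons of expr & expr
  | Hd of expr
  | Tl of expr.

Inductive cmd : Type :=
  | Assign of nat & expr
  | Seq of cmd & cmd
  | If of expr & cmd & cmd
  | While of expr & cmd.

Definition store := nat -> tree.

Definition update (s : store) (x : nat) (v : tree) : store :=
  fun y => if y == x then v else s y.

Fixpoint eval (e : expr) (s : store) : tree :=
  match e with
  | Var x => s x
  | Nil => Leaf
  | Cons e1 e2 => Node (eval e1 s) (eval e2 s)
  | Hd e1 => thd (eval e1 s)
  | Tl e1 => ttl (eval e1 s)
  end.

Fixpoint ecost (e : expr) : nat :=
  match e with
  | Var _ | Nil => 1
  | Cons e1 e2 => (ecost e1 + ecost e2).+1
  | Hd e1 | Tl e1 => (ecost e1).+1
  end.

(* [exec c s n s']: started in [s], [c] halts in [s'] after time [n].  In tests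
   [Leaf] stands for false and every other tree for true. *)
Inductive exec : cmd -> store -> nat -> store -> Prop :=
  | ExecAssign x e s :
      exec (Assign x e) s (ecost e).+1 (update s x (eval e s))
  | ExecSeq c1 c2 s s1 s2 n1 n2 :
      exec c1 s n1 s1 -> exec c2 s1 n2 s2 ->
      exec (Seq c1 c2) s (n1 + n2) s2
  | ExecIfTrue e c1 c2 s s1 n :
      eval e s <> Leaf -> exec c1 s n s1 ->
      exec (If e c1 c2) s (ecost e + n).+1 s1
  | ExecIfFalse e c1 c2 s s1 n :
      eval e s = Leaf -> exec c2 s n s1 ->
      exec (If e c1 c2) s (ecost e + n).+1 s1
  | ExecWhileTrue e c s s1 s2 n1 n2 :
      eval e s <> Leaf -> exec c s n1 s1 -> exec (While e c) s1 n2 s2 ->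
      exec (While e c) s (ecost e + n1 + n2).+1 s2
  | ExecWhileFalse e c s :
      eval e s = Leaf ->
      exec (While e c) s (ecost e).+1 s.

Definition init (input : tree) : store := update (fun=> Leaf) 0 input.

(* [exec] is deterministic, so [n] and [output] are functions of [c] and
   [input]. *)
Definition runs (c : cmd) (input : tree) (n : nat) (output : tree) : Prop :=
  exists2 s : store, exec c (init input) n s & s 0 = output.

Definition enc_bool (b : bool) : tree := if b then Node Leaf Leaf else Leaf.

(* Unary.  Vertex names bounded by the order of a graph that is itself given by
   its adjacency matrix may be written in unary without changing the input size
   by more than a polynomial. *)
Definition enc_nat (n : nat) : tree := iter n (Node Leaf) Leaf.

Definition enc_pair (A B : Type) (a : A -> tree) (b : B -> tree) (p : A * B) :
  tree := Node (a p.1) (b p.2).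

Definition enc_seq (A : Type) (a : A -> tree) (l : seq A) : tree :=
  foldr (fun x t => Node (a x) t) Leaf l.

Definition computable (f : nat -> nat) : Prop :=
  exists c : cmd, forall k : nat, exists n : nat,
    runs c (enc_nat k) n (enc_nat (f k)).

Record param_problem := ParamProblem {
  instance : Type;
  encoding : instance -> tree;
  parameter : instance -> nat;
  is_yes : instance -> Prop
}.

Definition input_size (Q : param_problem) (I : instance Q) : nat :=
  tsize (encoding I).

Definition FPT (Q : param_problem) : Prop :=
  exists (c : cmd) (f : nat -> nat) (d : nat),
    computable f /\
    forall I : instance Q, exists (n : nat) (output : tree),
      [/\ runs c (encoding I) n output,
          output <> Leaf <-> is_yes I
        & n <= f (parameter I) * input_size I ^ d].

Record graph := Graph {
  order : nat;
  adj : rel 'I_order;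
  adj_sym : symmetric adj;
  adj_irr : irreflexive adj
}.

Definition vertex (G : graph) := 'I_(order G).

Definition enc_vertex (G : graph) (v : vertex G) : tree := enc_nat v.

Definition enc_graph (G : graph) : tree :=
  enc_seq (fun u => enc_seq (fun v => enc_bool (@adj G u v))
                            (enum 'I_(order G)))
          (enum 'I_(order G)).

Section Paths.

Variable G : graph.
Implicit Types (u v : vertex G) (p : seq (vertex G)).

(* A path is the sequence of all its vertices, both ends included. *)
Definition is_path u v p : bool :=
  if p is x :: q then [&& x == u, path (@adj G) x q, last x q == v & uniq p]
  else false.

(* Comparing numbers of vertices amounts to comparing lengths. *)
Definition shortest_path u v p : Prop :=
  is_path u v p /\ forall q, is_path u v q -> size p <= size q.

End Paths.

Record ipct_instance := IPCTInstance {
  ipct_graph : graph;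
  ipct_k : nat;
  ipct_pairs : ipct_k.-tuple (vertex ipct_graph * vertex ipct_graph)
}.

Definition ipct_yes (I : ipct_instance) : Prop :=
  exists P : 'I_(ipct_k I) -> seq (vertex (ipct_graph I)),
    (forall i, shortest_path (tnth (ipct_pairs I) i).1
                             (tnth (ipct_pairs I) i).2 (P i)) /\
    (forall x : vertex (ipct_graph I), exists i, x \in P i).

Definition isometric_path_cover_with_terminals : param_problem :=
  {| instance := ipct_instance;
     encoding := fun I =>
       Node (enc_graph (ipct_graph I))
            (enc_seq (enc_pair (@enc_vertex _) (@enc_vertex _))
                     (ipct_pairs I));
     parameter := ipct_k;
     is_yes := ipct_yes |}.

Record sgst_instance := SGSTInstance {
  sgst_graph : graph;
  sgst_terminals : {set 'I_(order sgst_graph)}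
}.

(* The paths are indexed by the 2-element subsets of the set of terminals. *)
Definition sgst_yes (I : sgst_instance) : Prop :=
  let S := sgst_terminals I in
  exists P : {set 'I_(order (sgst_graph I))} -> seq (vertex (sgst_graph I)),
    (forall u v, u \in S -> v \in S -> u != v ->
       shortest_path u v (P [set u; v]) \/ shortest_path v u (P [set u; v])) /\
    (forall x : vertex (sgst_graph I),
       exists u v, [/\ u \in S, v \in S, u != v & x \in P [set u; v]]).

Definition strong_geodetic_set_with_terminals : param_problem :=
  {| instance := sgst_instance;
     encoding := fun I =>
       Node (enc_graph (sgst_graph I))
            (enc_seq (@enc_vertex _) (enum (sgst_terminals I)));
     parameter := fun I => #|sgst_terminals I|;
     is_yes := sgst_yes |}.

(* Main.v *)
(** The paths are confined to layers of bounded size.  Let [delta] be the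
    distance to the set of all the [s_i].  If [k] shortest paths cover the
    graph, a geodesic from the sources to a vertex can be cut into at most [k]
    pieces, each of which runs along one of the paths.  Call a set radial when
    the distance between any two of its points is the difference of their
    [delta]; such a set has at most one vertex in each layer of [delta].  A path
    being isometric, the vertices that are reached along it from a radial set
    form at most 20 radial sets, hence every layer has at most [k (20 k)^k]
    vertices.

    That a family of vertex sets is a family of shortest paths is a local
    condition: every vertex of the [i]-th set other than [s_i] has a neighbour
    one step closer to [s_i] in that set, and every vertex other than [t_i] has
    exactly one neighbour one step farther.  One may therefore enumerate the
    candidates on windows of three consecutive layers and look for a sequence of
    consistent candidates.  This takes polynomial time in the size of the input
    and in that of a padding that bounds the number of candidates and is computed
    beforehand from the parameter. *)
From HB Require Import structures.
From mathcomp Require Import all_boot zify.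
Require Import Defs.

Set Implicit Arguments.
Unset Strict Implicit.
Unset Printing Implicit Defensive.

(** * Programs *)

(** A shortest path need not be monotone in [delta]: it may cross the same layer many times, so no
    sweep over the layers can follow it from end to end. This is why the search handles sets of
    pairs of a vertex and a path index, and why the conditions on them use distances to [s_i], which
    are computable in advance: a set that obeys them is a single chain, without any bookkeeping of
    connectivity. Windows of three layers suffice because an edge changes [delta] by at most one, so
    that a window shows all neighbours of the vertices of its middle layer.

    All this has to be done by actual programs. To avoid timing programs whose cost depends on the
    parameter, everything except the padding is built inside a class of polynomial-time functions
    closed under composition, iteration with bounded values and list operations. Only the length of
    the padding, a tower of exponentials in the parameter, escapes this class, and its time is
    measured against its own value. *)

(* Variable 0 holds the argument and then the result, variable 1 a stack that
   has to be restored; the other variables are scratch. *)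
Definition computes (c : cmd) (f : tree -> tree) (T : tree -> nat) : Prop :=
  forall s : store, exists n s',
    [/\ exec c s n s', s' 0 = f (s 0), s' 1 = s 1 & n <= T (s 0)].

Lemma computes_ext c f g T : f =1 g -> computes c f T -> computes c g T.
Proof.
move=> fg cf s; have [n [s' [? s'0 ? ?]]] := cf s.
by exists n, s'; split=> //; rewrite -fg.
Qed.

Lemma computes_assign e f :
  (forall s, eval e s = f (s 0)) -> computes (Assign 0 e) f (fun=> (ecost e).+1).
Proof.
move=> ef s; exists (ecost e).+1, (update s 0 (eval e s)).
by split=> //; [exact: ExecAssign | rewrite /update /=].
Qed.

Lemma computes_comp c1 c2 f g T1 T2 :
  computes c1 f T1 -> computes c2 g T2 ->
  computes (Seq c1 c2) (fun t => g (f t)) (fun t => T1 t + T2 (f t)).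
Proof.
move=> cf cg s; have [n1 [s1 [e1 s10 s11 le1]]] := cf s.
have [n2 [s2 [e2 s20 s21 le2]]] := cg s1.
exists (n1 + n2), s2; split; first exact: ExecSeq e1 e2.
- by rewrite s20 s10.
- by rewrite s21 s11.
- by rewrite leq_add // -s10.
Qed.

Lemma exec_assign_seq x e c s n s' :
  exec c (update s x (eval e s)) n s' ->
  exec (Seq (Assign x e) c) s ((ecost e).+1 + n) s'.
Proof. exact/ExecSeq/ExecAssign. Qed.

(** The argument waits on the stack while [c1] runs and is then exchanged there for the value of
    [c1] while [c2] runs. Variable 2 serves only between calls, since both commands may overwrite
    it. *)
Definition node_cmd c1 c2 : cmd :=
  Seq (Assign 1 (Cons (Var 0) (Var 1)))
 (Seq c1
 (Seq (Assign 2 (Hd (Var 1)))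
 (Seq (Assign 1 (Cons (Var 0) (Tl (Var 1))))
 (Seq (Assign 0 (Var 2))
 (Seq c2
 (Seq (Assign 0 (Cons (Hd (Var 1)) (Var 0)))
      (Assign 1 (Tl (Var 1))))))))).

Lemma computes_node c1 c2 f g T1 T2 :
  computes c1 f T1 -> computes c2 g T2 ->
  computes (node_cmd c1 c2) (fun t => Node (f t) (g t))
           (fun t => T1 t + T2 t + 30).
Proof.
move=> cf cg s.
have [n1 [s1 [e1 s10 s11 le1]]] := cf (update s 1 (Node (s 0) (s 1))).
pose s2 := update s1 2 (thd (s1 1)).
pose s3 := update s2 1 (Node (s2 0) (ttl (s2 1))).
pose s4 := update s3 0 (s3 2).
have [n2 [s5 [e5 s50 s51 le2]]] := cg s4.
pose s6 := update s5 0 (Node (thd (s5 1)) (s5 0)).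
exists (4 + (n1 + (3 + (5 + (2 + (n2 + (5 + 3))))))), (update s6 1 (ttl (s6 1))).
have s40 : s4 0 = s 0 by rewrite /s4 /s3 /s2 /update /= s11 /update.
have s41 : s4 1 = Node (f (s 0)) (s 1).
  by rewrite /s4 /s3 /s2 /update /= s10 s11 /update.
split.
- apply: exec_assign_seq; apply: ExecSeq e1 _.
  apply: exec_assign_seq; apply: exec_assign_seq.
  apply: exec_assign_seq; apply: ExecSeq e5 _.
  by apply: exec_assign_seq; apply: ExecAssign.
- by rewrite /s6 /update /= s50 s51 s41 s40.
- by rewrite /s6 /update /= s51 s41.
- move: le1 le2; rewrite s40 /update /=; lia.
Qed.

Definition isn (t : tree) : bool := if t is Node _ _ then true else false.

Definition if_cmd c c1 c2 : cmd :=
  Seq (Assign 1 (Cons (Var 0) (Var 1)))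
 (Seq c
 (Seq (Assign 2 (Var 0))
 (Seq (Assign 0 (Hd (Var 1)))
 (Seq (Assign 1 (Tl (Var 1)))
      (If (Var 2) c1 c2))))).

Lemma computes_if c c1 c2 b f g T T1 T2 :
  computes c b T ->
  computes c1 f T1 -> computes c2 g T2 ->
  computes (if_cmd c c1 c2) (fun t => if isn (b t) then f t else g t)
           (fun t => T t + T1 t + T2 t + 30).
Proof.
move=> cb cf cg s.
have [n [s1 [e1 s10 s11 le1]]] := cb (update s 1 (Node (s 0) (s 1))).
pose s2 := update s1 2 (s1 0).
pose s3 := update s2 0 (thd (s2 1)).
pose s4 := update s3 1 (ttl (s3 1)).
have s40 : s4 0 = s 0 by rewrite /s4 /s3 /s2 /update /= s11 /update.
have s41 : s4 1 = s 1 by rewrite /s4 /s3 /s2 /update /= s11 /update.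
have s42 : s4 2 = b (s 0) by rewrite /s4 /s3 /s2 /update /= s10.
have run m s' : exec (If (Var 2) c1 c2) s4 m s' ->
    exec (if_cmd c c1 c2) s (4 + (n + (2 + (3 + (3 + m))))) s'.
  move=> e; apply: exec_assign_seq; apply: ExecSeq e1 _.
  apply: exec_assign_seq; apply: exec_assign_seq.
  by apply: exec_assign_seq; exact: e.
case b0: (b (s 0)) => [|a r] /=; last first.
- have [m [s5 [e5 s50 s51 le5]]] := cf s4.
  have e6 : exec (If (Var 2) c1 c2) s4 (1 + m).+1 s5.
    by apply: ExecIfTrue e5; rewrite /= ?s42 ?b0.
  exists (4 + (n + (2 + (3 + (3 + (1 + m).+1))))), s5; split.
  + exact: run.
  + by rewrite s50 s40.
  + by rewrite s51 s41.
  + by move: le1 le5; rewrite s40 /update /=; lia.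
- have [m [s5 [e5 s50 s51 le5]]] := cg s4.
  have e6 : exec (If (Var 2) c1 c2) s4 (1 + m).+1 s5.
    by apply: ExecIfFalse e5; rewrite /= ?s42 ?b0.
  exists (4 + (n + (2 + (3 + (3 + (1 + m).+1))))), s5; split.
  + exact: run.
  + by rewrite s50 s40.
  + by rewrite s51 s41.
  + by move: le1 le5; rewrite s40 /update /=; lia.
Qed.

(* A tree is read as the list of the trees along its right spine. *)
Fixpoint lst (t : tree) : seq tree := if t is Node a b then a :: lst b else [::].

Definition unl : seq tree -> tree := foldr Node Leaf.

Definition spine (t : tree) : nat := size (lst t).

Lemma unlK : cancel unl lst.
Proof. by elim=> //= x l ->. Qed.

Lemma lstK : cancel lst unl.
Proof. by elim=> //= a _ b ->. Qed.

Lemma spine_unl l : spine (unl l) = size l.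
Proof. by rewrite /spine unlK. Qed.

(** The loop counter sits on the stack because [c] preserves nothing else; each turn removes one
    cell of its spine. *)
Definition iter_cmd c : cmd :=
  Seq (Assign 1 (Cons (Hd (Var 0)) (Var 1)))
 (Seq (Assign 0 (Tl (Var 0)))
 (Seq (While (Hd (Var 1))
        (Seq c (Assign 1 (Cons (Tl (Hd (Var 1))) (Tl (Var 1))))))
      (Assign 1 (Tl (Var 1))))).

Lemma computes_iter c f T :
  computes c f T ->
  computes (iter_cmd c) (fun t => iter (spine (thd t)) f (ttl t))
    (fun t => \sum_(j < spine (thd t)) (T (iter j f (ttl t)) + 10) + 20).
Proof.
move=> cf s.
have loop r st : forall s, s 1 = Node r st -> exists n s', [/\
    exec (While (Hd (Var 1))
        (Seq c (Assign 1 (Cons (Tl (Hd (Var 1))) (Tl (Var 1)))))) s n s',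
    s' 0 = iter (spine r) f (s 0), ttl (s' 1) = st &
    n <= \sum_(j < spine r) (T (iter j f (s 0)) + 10) + 3].
  elim: r => [|a _ r IH] s0 s01.
    exists 3, s0; split=> //; [|by rewrite s01 | by rewrite big_ord0].
    by apply: ExecWhileFalse; rewrite /= s01.
  have [n1 [s3 [e3 s30 s31 le3]]] := cf s0.
  pose s4 := update s3 1 (Node (ttl (thd (s3 1))) (ttl (s3 1))).
  have s41 : s4 1 = Node r st by rewrite /s4 /update /= s31 s01.
  have [n2 [s5 [e5 s50 s51 le5]]] := IH s4 s41.
  exists (2 + (n1 + 7) + n2).+1, s5; split.
  - apply: ExecWhileTrue e5; first by rewrite /= s01.
    exact: ExecSeq e3 (ExecAssign _ _ _).
  - by rewrite s50 /s4 /update /= s30 /spine /= -iterSr.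
  - by rewrite s51.
  - rewrite /spine /= big_ord_recl /=.
    move: le5; rewrite /s4 /update /= s30.
    under eq_bigr do rewrite -iterSr.
    rewrite -/(spine r); move: le3; rewrite /=; set S1 := bigop _ _ _ => ? ?; lia.
pose s1 := update s 1 (Node (thd (s 0)) (s 1)).
pose s2 := update s1 0 (ttl (s1 0)).
have [n [s3 [e3 s30 s31 le3]]] := loop (thd (s 0)) (s 1) s2 erefl.
exists (5 + (3 + (n + 3))), (update s3 1 (ttl (s3 1))); split=> //.
- apply: exec_assign_seq; apply: exec_assign_seq.
  exact: ExecSeq e3 (ExecAssign _ _ _).
- move: le3; have -> : s2 0 = ttl (s 0) by []; rewrite /=; set S1 := bigop _ _ _ => ?; lia.
Qed.

(** * Polynomial time *)

Lemma tsize_gt0 t : 0 < tsize t.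
Proof. by case: t. Qed.

Lemma spine_lt t : spine t < tsize t.
Proof. by elim: t => //= a _ b; rewrite /spine /=; lia. Qed.

Lemma tsize_thd t : tsize (thd t) <= tsize t.
Proof. by case: t => //= a b; lia. Qed.

Lemma tsize_ttl t : tsize (ttl t) <= tsize t.
Proof. by case: t => //= a b; lia. Qed.

Lemma tsize_iter_ttl j t : tsize (iter j ttl t) <= tsize t.
Proof. by elim: j => //= j; apply: leq_trans (tsize_ttl _). Qed.

Lemma spine_iter_ttl j t : spine (iter j ttl t) = spine t - j.
Proof.
have spS u : spine (ttl u) = (spine u).-1 by case: u.
by elim: j => [|j IH] /=; rewrite ?subn0 // spS IH subnS.
Qed.

Lemma thd_iter_ttl j t : thd (iter j ttl t) = nth Leaf (lst t) j.
Proof. by elim: t j => [|a _ b IHb] [|j] //; rewrite iterSr //= iter_fix. Qed.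

Lemma isn_spine t : isn t = (0 < spine t).
Proof. by case: t. Qed.

Lemma isn_enc_bool b : isn (enc_bool b) = b.
Proof. by case: b. Qed.

(** The base is at least 2, so that constants are bounded by a power as well. *)
Definition polyb (T : tree -> nat) : Prop :=
  exists d, forall t, T t <= (tsize t).+1 ^ d.

Lemma polyb_le T T' : (forall t, T t <= T' t) -> polyb T' -> polyb T.
Proof. by move=> le [d T'd]; exists d => t; apply: leq_trans (le t) _. Qed.

Lemma polyb_cst n : polyb (fun=> n).
Proof.
by exists n => t; apply/ltnW/ltn_expl; rewrite ltnS tsize_gt0.
Qed.

Lemma polyb_tsize : polyb tsize.
Proof. by exists 1 => t; rewrite expn1. Qed.

Lemma polyb_mul T1 T2 : polyb T1 -> polyb T2 -> polyb (fun t => T1 t * T2 t).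
Proof. by case=> [d1 T1d] [d2 T2d]; exists (d1 + d2) => t; rewrite expnD leq_mul. Qed.

Lemma polyb_add T1 T2 : polyb T1 -> polyb T2 -> polyb (fun t => T1 t + T2 t).
Proof.
case=> [d1 T1d] [d2 T2d].
have: polyb (fun t => 2 * ((tsize t).+1 ^ d1 * (tsize t).+1 ^ d2)).
  apply: polyb_mul; first exact: polyb_cst.
  by apply: polyb_mul; [exists d1 | exists d2].
apply: polyb_le => t; apply: leq_trans (leq_add (T1d t) (T2d t)) _.
have: 0 < (tsize t).+1 ^ d1 by rewrite expn_gt0.
have: 0 < (tsize t).+1 ^ d2 by rewrite expn_gt0.
by move: (_ ^ d1) (_ ^ d2) => [|x] [|y] // _ _; nia.
Qed.

Lemma polyb_exp T d : polyb T -> polyb (fun t => T t ^ d).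
Proof.
move=> [e Te]; exists (e * d) => t; rewrite expnM.
by case: d => // d; rewrite leq_exp2r.
Qed.

Lemma polyb_comp T g : polyb T -> polyb (fun t => tsize (g t)) -> polyb (fun t => T (g t)).
Proof.
move=> [d Td] gb; apply: (polyb_le (fun t => Td (g t))).
apply: polyb_exp; apply: polyb_le (polyb_add gb (polyb_cst 1)) => t.
by rewrite addn1.
Qed.

(** The bound on the size of the value does not follow from the bound on time: consing a tree with
    itself doubles its size at constant cost. Composition needs both. *)
Definition PT (f : tree -> tree) : Prop :=
  exists c T, [/\ computes c f T, polyb T & polyb (fun t => tsize (f t))].

Lemma PT_size f : PT f -> polyb (fun t => tsize (f t)).
Proof. by case=> c [T []]. Qed.

Lemma PT_ext f g : f =1 g -> PT f -> PT g.
Proof.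
move=> fg [c [T [cf bT bf]]]; exists c, T; split=> //.
- exact: computes_ext cf.
- by apply: polyb_le bf => t; rewrite fg.
Qed.

Lemma PT_comp g f : PT g -> PT f -> PT (fun t => g (f t)).
Proof.
move=> [c [T [cf bT bf]]] [c' [T' [cf' bT' bf']]].
exists (Seq c' c), (fun t => T' t + T (f t)); split.
- exact: computes_comp.
- exact: polyb_add bT' (polyb_comp bT bf').
- exact: (polyb_comp (T := fun t => tsize (g t))).
Qed.

Lemma PT_id : PT (fun t => t).
Proof.
exists (Assign 0 (Var 0)), (fun=> 2); split.
- exact: computes_assign.
- exact: polyb_cst.
- exact: polyb_tsize.
Qed.

Lemma PT_leaf : PT (fun=> Leaf).
Proof.
exists (Assign 0 Nil), (fun=> 2); split; try exact: polyb_cst.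
exact: computes_assign.
Qed.

Lemma PT_thd f : PT f -> PT (fun t => thd (f t)).
Proof.
apply: PT_comp; exists (Assign 0 (Hd (Var 0))), (fun=> 3); split.
- exact: computes_assign.
- exact: polyb_cst.
- exact: polyb_le tsize_thd polyb_tsize.
Qed.

Lemma PT_ttl f : PT f -> PT (fun t => ttl (f t)).
Proof.
apply: PT_comp; exists (Assign 0 (Tl (Var 0))), (fun=> 3); split.
- exact: computes_assign.
- exact: polyb_cst.
- exact: polyb_le tsize_ttl polyb_tsize.
Qed.

Lemma PT_node f g : PT f -> PT g -> PT (fun t => Node (f t) (g t)).
Proof.
move=> [c [T [cf bT bf]]] [c' [T' [cf' bT' bf']]].
exists (node_cmd c c'), (fun t => T t + T' t + 30); split.
- exact: computes_node.
- by do 2?[apply: polyb_add => //]; exact: polyb_cst.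
- apply: polyb_le (polyb_add (polyb_add bf bf') (polyb_cst 1)) => t /=; lia.
Qed.

Lemma PT_ifn b f g : PT b -> PT f -> PT g ->
  PT (fun t => if isn (b t) then f t else g t).
Proof.
move=> [c0 [T0 [cb bT0 bb]]] [c [T [cf bT bf]]] [c' [T' [cf' bT' bf']]].
exists (if_cmd c0 c c'), (fun t => T0 t + T t + T' t + 30); split.
- exact: computes_if.
- by do 3?[apply: polyb_add => //]; exact: polyb_cst.
- apply: polyb_le (polyb_add bf bf') => t /=; case: ifP => _; lia.
Qed.

Definition PT2 F : Prop := PT (fun p => F (thd p) (ttl p)).

(** Iterating a polynomial-time function may produce values of exponential size, hence the bound [B]
    on all intermediate ones. The loop runs on pairs that carry [t] along, since the body depends on
    it. *)
Lemma PT_iter F cnt init B :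
  PT2 F -> PT cnt -> PT init -> polyb B ->
  (forall t j, j <= spine (cnt t) -> tsize (iter j (F t) (init t)) <= B t) ->
  PT (fun t => iter (spine (cnt t)) (F t) (init t)).
Proof.
move=> PF Pcnt Pinit bB le_B.
have [c [T [cG [d Td] _]]] : PT (fun p => Node (thd p) (F (thd p) (ttl p))).
  by apply: PT_node => //; apply: PT_thd PT_id.
pose arg t := Node (cnt t) (Node t (init t)).
have Parg : PT arg by do !apply: PT_node => //; apply: PT_id.
have iterE t j : iter j (fun p => Node (thd p) (F (thd p) (ttl p)))
    (Node t (init t)) = Node t (iter j (F t) (init t)).
  by elim: j => //= j ->.
have [c1 [T1 [carg bT1 barg]]] := Parg.
exists (Seq (Seq c1 (iter_cmd c)) (Assign 0 (Tl (Var 0)))); eexists; split.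
- apply: computes_ext; last first.
    apply: computes_comp (computes_comp carg (computes_iter cG)) _.
    exact: (@computes_assign _ ttl).
  by move=> t /=; rewrite iterE.
- rewrite /=; apply: polyb_add; last exact: polyb_cst.
  apply: polyb_add => //; apply: polyb_add; last exact: polyb_cst.
  have: polyb (fun t => tsize (cnt t) * ((tsize t + B t + 2) ^ d + 10)).
    apply: polyb_mul; first exact: PT_size.
    apply: polyb_add; last exact: polyb_cst.
    apply: polyb_exp; apply: polyb_add; last exact: polyb_cst.
    exact: polyb_add polyb_tsize bB.
  apply: polyb_le => t.
  have: \sum_(j < spine (cnt t)) ((tsize t + B t + 2) ^ d + 10) <=
        tsize (cnt t) * ((tsize t + B t + 2) ^ d + 10).
    by rewrite sum_nat_const card_ord leq_mul // ltnW // spine_lt.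
  apply: leq_trans; apply: leq_sum => j _; rewrite leq_add2r iterE.
  apply: leq_trans (Td _) _; have := le_B t j (ltnW (ltn_ord j)).
  by case: (d) => // d' ?; rewrite leq_exp2r //=; lia.
- by apply: polyb_le bB => t; exact: le_B.
Qed.

Definition PTb (p : tree -> bool) : Prop := PT (fun t => enc_bool (p t)).

Lemma PT_if p f g : PTb p -> PT f -> PT g ->
  PT (fun t => if p t then f t else g t).
Proof.
move=> Pp Pf Pg; apply: PT_ext (PT_ifn Pp Pf Pg) => t.
by rewrite isn_enc_bool.
Qed.

Lemma PTb_isn f : PT f -> PTb (fun t => isn (f t)).
Proof.
move=> Pf; apply: PT_ext (PT_ifn Pf (PT_node PT_leaf PT_leaf) PT_leaf) => t.
by case: isn.
Qed.

Lemma PTb_ext p q : p =1 q -> PTb p -> PTb q.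
Proof. by move=> pq; apply: PT_ext => t; rewrite pq. Qed.

Lemma PTb_neg p : PTb p -> PTb (fun t => ~~ p t).
Proof.
move=> Pp; apply: PT_ext (PT_if Pp PT_leaf (PT_node PT_leaf PT_leaf)) => t.
by case: (p t).
Qed.

Lemma PTb_and p q : PTb p -> PTb q -> PTb (fun t => p t && q t).
Proof.
by move=> Pp Pq; apply: PT_ext (PT_if Pp Pq PT_leaf) => t; case: (p t).
Qed.

Lemma PTb_or p q : PTb p -> PTb q -> PTb (fun t => p t || q t).
Proof.
move=> Pp Pq; apply: PTb_ext (PTb_neg (PTb_and (PTb_neg Pp) (PTb_neg Pq))) => t.
by rewrite negb_and !negbK.
Qed.

Lemma PTb_imp p q : PTb p -> PTb q -> PTb (fun t => p t ==> q t).
Proof. by move=> Pp Pq; apply: PTb_ext (PTb_or (PTb_neg Pp) Pq) => t; rewrite implybE. Qed.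

(** * Unary numbers and lists in polynomial time *)

Lemma PT_drop f g : PT f -> PT g -> PT (fun t => iter (spine (f t)) ttl (g t)).
Proof.
move=> Pf Pg; apply: (PT_iter (F := fun _ => ttl) (B := fun t => tsize (g t))) => //.
- exact: PT_ttl (PT_ttl PT_id).
- exact: PT_size.
- by move=> t j _; apply: tsize_iter_ttl.
Qed.

Lemma PTb_leq f g : PT f -> PT g -> PTb (fun t => spine (f t) <= spine (g t)).
Proof.
move=> Pf Pg; apply: PTb_ext (PTb_neg (PTb_isn (PT_drop Pg Pf))) => t.
by rewrite isn_spine spine_iter_ttl; lia.
Qed.

Lemma PTb_eq f g : PT f -> PT g -> PTb (fun t => spine (f t) == spine (g t)).
Proof.
move=> Pf Pg; apply: PTb_ext (PTb_and (PTb_leq Pf Pg) (PTb_leq Pg Pf)) => t.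
by rewrite -eqn_leq.
Qed.

Definition tree_nth (l : tree) (i : nat) : tree := nth Leaf (lst l) i.

Lemma PT_nth f g : PT f -> PT g -> PT (fun t => tree_nth (f t) (spine (g t))).
Proof.
move=> Pf Pg; apply: PT_ext (PT_thd (PT_drop Pg Pf)) => t; rewrite /tree_nth.
exact: thd_iter_ttl.
Qed.

(** The loop state pairs the accumulator with the part of the list still to be read; [B] has to
    bound the accumulator after every prefix. *)
Lemma PT_foldl F l init B :
  PT (fun p => F (thd p) (thd (ttl p)) (ttl (ttl p))) ->
  PT l -> PT init -> polyb B ->
  (forall t j, tsize (foldl (F t) (init t) (take j (lst (l t)))) <= B t) ->
  PT (fun t => foldl (F t) (init t) (lst (l t))).
Proof.
move=> PF Pl Pinit bB le_B.
pose G t p := Node (F t (thd p) (thd (ttl p))) (ttl (ttl p)).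
have iterE t j : j <= spine (l t) -> iter j (G t) (Node (init t) (l t)) =
    Node (foldl (F t) (init t) (take j (lst (l t)))) (iter j ttl (l t)).
  elim: j => [|j IH] lt_j; first by rewrite take0.
  rewrite /= IH ?(ltnW lt_j) // (take_nth Leaf) // -cats1 foldl_cat /= /G /=.
  by rewrite thd_iter_ttl.
suff: PT (fun t => thd (iter (spine (l t)) (G t) (Node (init t) (l t)))).
  by apply: PT_ext => t; rewrite iterE //= take_oversize.
apply: PT_thd; apply: (PT_iter (B := fun t => B t + tsize (l t) + 1)) => //.
- apply: PT_node; last by do 3!apply: PT_ttl; apply: PT_id.
  pose h p := Node (thd p) (Node (thd (ttl p)) (thd (ttl (ttl p)))).
  apply: (PT_comp (f := h) PF).
  by do !(apply: PT_node || apply: PT_thd || apply: PT_ttl || apply: PT_id).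
- exact: PT_node.
- apply: polyb_add (polyb_cst 1); exact: polyb_add bB (PT_size Pl).
- move=> t j le_j; rewrite iterE //=.
  have := le_B t j; have := tsize_iter_ttl j (l t); lia.
Qed.

(** The additive part of the size of a list: [tsize (unl l)] is one more. *)
Definition wsize (l : seq tree) : nat := sumn [seq (tsize x).+1 | x <- l].

Lemma wsize_cat l l' : wsize (l ++ l') = wsize l + wsize l'.
Proof. by rewrite /wsize map_cat sumn_cat. Qed.

Lemma wsize_lst t : wsize (lst t) = (tsize t).-1.
Proof. by elim: t => //= a _ b; rewrite /wsize /= => ->; have := tsize_gt0 b; lia. Qed.

Lemma tsize_unl l : tsize (unl l) = (wsize l).+1.
Proof. by have := wsize_lst (unl l); rewrite unlK; have := tsize_gt0 (unl l); lia. Qed.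

Lemma wsize_take j l : wsize (take j l) <= wsize l.
Proof. by rewrite -[in X in _ <= X](cat_take_drop j l) wsize_cat leq_addr. Qed.

Lemma wsize_rev l : wsize (rev l) = wsize l.
Proof. by rewrite /wsize map_rev sumn_rev. Qed.

Lemma PT_catrev f g : PT f -> PT g -> PT (fun t => unl (catrev (lst (f t)) (lst (g t)))).
Proof.
move=> Pf Pg.
have E l t : foldl (fun a x => Node x a) t l = unl (catrev l (lst t)).
  by elim: l t => [|x l IH] t /=; rewrite ?lstK // IH.
suff: PT (fun t => foldl (fun a x => Node x a) (g t) (lst (f t))).
  by apply: PT_ext => t; rewrite E.
apply: (PT_foldl (F := fun _ a x => Node x a)
    (B := fun t => tsize (f t) + tsize (g t))) => //.
- by do !(apply: PT_node || apply: PT_thd || apply: PT_ttl || apply: PT_id).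
- exact: polyb_add (PT_size Pf) (PT_size Pg).
move=> t j; rewrite E tsize_unl catrevE wsize_cat wsize_rev wsize_lst.
have := wsize_take j (lst (f t)); rewrite wsize_lst.
by have := tsize_gt0 (f t); have := tsize_gt0 (g t); lia.
Qed.

Definition tcat a b : tree := unl (lst a ++ lst b).

Lemma PT_cat f g : PT f -> PT g -> PT (fun t => tcat (f t) (g t)).
Proof.
move=> Pf Pg; apply: PT_ext (PT_catrev (PT_catrev Pf PT_leaf) Pg) => t.
by rewrite unlK /= -/(rev _) catrevE revK.
Qed.

Definition tflat (F : tree -> tree) (l : tree) : tree :=
  unl (flatten [seq lst (F x) | x <- lst l]).

(** No bound on intermediate values is asked for: each element contributes a list of size polynomial
    in those of [t] and [l t], and the contributions only add up. *)
Lemma PT_flat F l : PT2 F -> PT l -> PT (fun t => tflat (F t) (l t)).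
Proof.
move=> PF Pl.
have E t s a : foldl (fun a x => tcat a (F t x)) a s =
    unl (lst a ++ flatten [seq lst (F t x) | x <- s]).
  elim: s a => [|x s IH] a /=; first by rewrite cats0 lstK.
  by rewrite IH /tcat unlK catA.
suff: PT (fun t => foldl (fun a x => tcat a (F t x)) Leaf (lst (l t))).
  by apply: PT_ext => t; rewrite E.
have [d Fd] := PT_size PF.
apply: (PT_foldl (F := fun t a x => tcat a (F t x))
    (B := fun t => tsize (l t) * (tsize t + tsize (l t) + 2) ^ d + 1)) => //.
- apply: PT_cat; first by do !(apply: PT_thd || apply: PT_ttl || apply: PT_id).
  apply: (PT_comp (f := fun p => Node (thd p) (ttl (ttl p))) PF).
  by do !(apply: PT_node || apply: PT_thd || apply: PT_ttl || apply: PT_id).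
- exact: PT_leaf.
- apply: polyb_add (polyb_cst _); apply: polyb_mul; first exact: PT_size.
  apply: polyb_exp; apply: polyb_add (polyb_cst _).
  exact: polyb_add polyb_tsize (PT_size Pl).
move=> t j; rewrite E tsize_unl /= addn1 ltnS.
set M := _ ^ d.
have wF s : all (fun x => tsize x <= tsize (l t)) s ->
    wsize (flatten [seq lst (F t x) | x <- s]) <= size s * M.
  elim: s => [|x s IH] //= /andP[x_le /IH s_le]; rewrite wsize_cat mulSn leq_add //.
  rewrite wsize_lst; apply: leq_trans (leq_pred _) _.
  apply: leq_trans (Fd (Node t x)) _; rewrite /M.
  by case: (d) => // d' ; rewrite leq_exp2r //=; lia.
apply: leq_trans (wF _ _) _.
  have: all (fun x => tsize x <= tsize (l t)) (lst (l t)).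
    elim: (l t) => //= a _ b IH; rewrite leqW ?leq_addr //=.
    by apply: sub_all IH => x /=; lia.
  by rewrite -{1}(cat_take_drop j (lst (l t))) all_cat => /andP[].
rewrite leq_mul2r size_take_min; apply/orP; right.
by have := spine_lt (l t); rewrite /spine; lia.
Qed.

Definition tmap (F : tree -> tree) (l : tree) : tree := unl [seq F x | x <- lst l].
Definition tfilter (p : tree -> bool) (l : tree) : tree := unl [seq x <- lst l | p x].

Lemma PT_map F l : PT2 F -> PT l -> PT (fun t => tmap (F t) (l t)).
Proof.
move=> PF Pl; apply: PT_ext (PT_flat (F := fun t x => Node (F t x) Leaf) _ Pl).
  by move=> t; rewrite /tflat /tmap; elim: (lst _) => //= x s ->.
exact: PT_node PF PT_leaf.
Qed.

Definition PTb2 p : Prop := PTb (fun t => p (thd t) (ttl t)).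

Lemma PT_filter p l : PTb2 p -> PT l -> PT (fun t => tfilter (p t) (l t)).
Proof.
move=> Pp Pl; apply: PT_ext (PT_flat (F := fun t x =>
    if p t x then Node x Leaf else Leaf) _ Pl).
  by move=> t; rewrite /tflat /tfilter; elim: (lst _) => //= x s; case: ifP => //= _ ->.
apply: PT_if Pp _ PT_leaf; exact: PT_node (PT_ttl PT_id) PT_leaf.
Qed.

Lemma PTb_has p l : PTb2 p -> PT l -> PTb (fun t => has (p t) (lst (l t))).
Proof.
move=> Pp Pl; apply: PTb_ext (PTb_isn (PT_filter Pp Pl)) => t.
by rewrite isn_spine spine_unl size_filter has_count.
Qed.

Lemma PTb_all p l : PTb2 p -> PT l -> PTb (fun t => all (p t) (lst (l t))).
Proof.
move=> Pp Pl; have Pn : PTb2 (fun t x => ~~ p t x) by apply: PTb_neg.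
apply: PTb_ext (PTb_neg (PTb_has Pn Pl)) => t.
by rewrite has_predC negbK.
Qed.

Lemma lst_map F l : lst (tmap F l) = [seq F x | x <- lst l].
Proof. exact: unlK. Qed.

Lemma lst_filter p l : lst (tfilter p l) = [seq x <- lst l | p x].
Proof. exact: unlK. Qed.

Lemma lst_flat F l : lst (tflat F l) = flatten [seq lst (F x) | x <- lst l].
Proof. exact: unlK. Qed.

(** * Padding *)

Lemma enc_natE n : enc_nat n = unl (nseq n Leaf).
Proof. by elim: n => //= n <-. Qed.

Lemma spine_enc_nat n : spine (enc_nat n) = n.
Proof. by rewrite enc_natE spine_unl size_nseq. Qed.

Lemma tmap_leaf l : tmap (fun=> Leaf) l = enc_nat (spine l).
Proof. by rewrite enc_natE /tmap /spine; elim: (lst l) => //= x s ->. Qed.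

Lemma tsize_enc_nat n : tsize (enc_nat n) = n.*2.+1.
Proof. by elim: n => //= n ->; lia. Qed.

(* The running time is polynomial in the output, so that, [F] being inflationary,
   the property is preserved by composition. *)
Definition honest (F : nat -> nat) : Prop :=
  (forall m, m <= F m) /\
  exists c f T d, computes c f T /\ forall m,
    f (enc_nat m) = enc_nat (F m) /\ T (enc_nat m) <= (F m).+2 ^ d.

Lemma leq_exp_base a b d : a <= b -> a ^ d <= b ^ d.
Proof. by case: d => // d; rewrite leq_exp2r. Qed.

Lemma leq_exp_exponent a d e : 0 < a -> d <= e -> a ^ d <= a ^ e.
Proof. by case: a => // [[|a]] _ le; rewrite ?exp1n // leq_exp2l. Qed.

Lemma honest_comp F G : honest F -> honest G -> honest (fun m => G (F m)).
Proof.
move=> [le_F [c [f [T [d [cf fF]]]]]] [le_G [c' [f' [T' [d' [cf' fG]]]]]].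
split; first by move=> m; apply: leq_trans (le_F m) _.
exists (Seq c c'), (fun t => f' (f t)), (fun t => T t + T' (f t)), (d + d').+1.
split; first exact: computes_comp.
move=> m; have [fm Tm] := fF m; have [f'm T'm] := fG (F m).
rewrite fm f'm; split=> //; apply: leq_trans (leq_add Tm T'm) _.
have [le1 le2] : (F m).+2 ^ d <= (G (F m)).+2 ^ (d + d') /\
     (G (F m)).+2 ^ d' <= (G (F m)).+2 ^ (d + d').
  split; last by rewrite leq_exp2l // leq_addl.
  apply: leq_trans (leq_exp_base d (b := (G (F m)).+2) _) _; last by rewrite leq_exp2l // leq_addr.
  exact: le_G.
by rewrite expnS; nia.
Qed.

Lemma honest_succ : honest succn.
Proof.
split; first by move=> m; apply: leqnSn.
exists (Assign 0 (Cons Nil (Var 0))), (Node Leaf), (fun=> 4), 2; split.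
  exact: computes_assign.
by move=> m; split=> //; rewrite expnS expn1; nia.
Qed.

Lemma honest_id : honest id.
Proof.
split=> //; exists (Assign 0 (Var 0)), id, (fun=> 2), 1; split=> //.
exact: computes_assign.
Qed.

Lemma honest_iter F n : honest F -> honest (iter n F).
Proof.
move=> hF; elim: n => [|n IH]; first exact: honest_id.
exact: honest_comp IH hF.
Qed.

Lemma honest_addn c : honest (fun m => c + m).
Proof.
have [le [p [f [T [d [cf fF]]]]]] := honest_iter c honest_succ.
have E m : iter c succn m = c + m by elim: c {le fF} => //= c ->; rewrite addSn.
split=> [m|]; first exact: leq_addl.
by exists p, f, T, d; split=> // m; rewrite -E.
Qed.

(** A one-element list is doubled [m] times. No intermediate list is longer than the final one, so
    the time is polynomial in the output, though exponential in the input. *)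
Lemma honest_exp2 : honest (expn 2).
Proof.
split=> [m|]; first exact/ltnW/ltn_expl.
have [c [T [cD [d Td] _]]] : PT (fun t => tcat t t) by apply: PT_cat; apply: PT_id.
have [c1 [T1 [c1D [d1 Td1] _]]] : PT (fun t => Node t (Node Leaf Leaf)).
  by apply: PT_node PT_id _; apply: PT_node; apply: PT_leaf.
eexists; eexists; eexists; exists (d1 * 2 + d * 2 + 6); split.
  exact: (computes_comp c1D (computes_iter cD)).
move=> m /=; have dbl j : iter j (fun t => tcat t t) (Node Leaf Leaf) = enc_nat (2 ^ j).
  elim: j => //= j ->; rewrite /tcat !enc_natE !unlK -nseqD expnS.
  by rewrite mul2n -addnn.
rewrite spine_enc_nat dbl; split=> //.
have mX : m < 2 ^ m by apply: ltn_expl.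
set X := (2 ^ m).+2.
have X0 : 0 < X by [].
have XX : X * X = X ^ 2 by rewrite expnS expn1.
have le1 : T1 (enc_nat m) <= X ^ (d1 * 2 + d * 2).
  apply: leq_trans (Td1 _) _; rewrite tsize_enc_nat.
  apply: leq_trans (leq_exp_base d1 (b := X ^ 2) _) _; first by rewrite -XX /X; nia.
  by rewrite -expnM; apply: leq_exp_exponent; lia.
have le2 : \sum_(j < m) (T (iter j (fun t => tcat t t) (Node Leaf Leaf)) + 10) <=
    X * (X ^ (d1 * 2 + d * 2) + 10).
  apply: (@leq_trans (\sum_(j < m) (X ^ (d1 * 2 + d * 2) + 10))).
    apply: leq_sum => j _; rewrite leq_add2r dbl; apply: leq_trans (Td _) _.
    rewrite tsize_enc_nat.
    apply: leq_trans (leq_exp_base d (b := X ^ 2) _) _.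
      have : 2 ^ j <= 2 ^ m by rewrite leq_exp2l // ltnW.
      by rewrite -XX /X; nia.
    by rewrite -expnM; apply: leq_exp_exponent; lia.
  by rewrite sum_nat_const card_ord leq_mul2r; apply/orP; right; rewrite /X; lia.
have Y0 : 0 < X ^ (d1 * 2 + d * 2) by rewrite expn_gt0.
(* [X] is at least 3; four of the six spare factors [X] give 81, which absorbs the constants of the
   loop. *)
have X81 : 81 <= X ^ 4 by apply: (leq_exp_base 4 (a := 3)); rewrite /X; lia.
rewrite expnD (expnD X 1 5) expn1 (expnD X 1 4) expn1.
set Y := X ^ (_ + _) in le1 le2 Y0 *.
have YX : Y * X * 81 <= Y * (X * (X * X ^ 4)).
  by rewrite -mulnA !leq_mul2l; apply/orP; right; apply/orP; right;
    apply: leq_trans X81 _; rewrite leq_pmull.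
have : Y <= Y * X by rewrite leq_pmulr.
have : X <= Y * X by rewrite leq_pmull.
move: le1 le2 YX; rewrite mulnDr (mulnC X Y); clearbody Y X.
move: (Y * X) (Y * _) (bigop _ _ _) (T1 _) => *; lia.
Qed.

Lemma honest_computable F : honest F -> computable F.
Proof.
move=> [_ [c [f [T [d [cf fF]]]]]]; exists c => k.
have [n [s [e s0 _ _]]] := cf (init (enc_nat k)).
by exists n, s => //; rewrite s0; case: (fF k).
Qed.

(** With [D = d.+1] one has [x <= 2 ^ (x %/ D) * D]. Raising this to the power [D] leaves an
    exponent at most [x], and the factor [D ^ D] goes into [c]. *)
Lemma exp_poly_le d : exists c, forall x, x ^ d <= 2 ^ (c + x).
Proof.
case: d => [|d]; first by exists 0 => x; rewrite expn0 expn_gt0.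
exists (d.+1 ^ d.+1) => x; set D := d.+1.
have le1 : x <= 2 ^ (x %/ D) * D.
  apply: leq_trans (ltnW (ltn_ceil x (ltn0Sn d))) _.
  by rewrite leq_mul2r ltn_expl // orbT.
apply: leq_trans (leq_exp_base D le1) _; rewrite expnMn mulnC -expnM expnD.
by apply: leq_mul; [apply/ltnW/ltn_expl | rewrite leq_exp2l // leq_divM].
Qed.

(* A polynomial-time algorithm may be given, as padding, a list whose length is
   a computable function of the parameter. *)
Lemma FPT_padded (Q : param_problem) (A kappa : tree -> tree) (F : nat -> nat) :
  honest F -> PT A -> PT kappa ->
  (forall I : instance Q, kappa (encoding I) = enc_nat (parameter I)) ->
  (forall (I : instance Q) pad, F (parameter I) <= spine pad ->
     A (Node pad (encoding I)) <> Leaf <-> is_yes I) ->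
  FPT Q.
Proof.
move=> hF [cA [TA [cAD [dA TdA] _]]] [ck [Tk [ckD [dk Tdk] _]]] kE AE.
have [_ [cF [fF [TF [dF [cFD fFE]]]]]] := hF.
pose D := dA + dk + dF.
have [c Dc] := exp_poly_le D.
exists (Seq (node_cmd (Seq ck cF) (Assign 0 (Var 0))) cA).
(* One further exponential absorbs the powers of [F k], by [exp_poly_le]; the summands 6 and [2 * D]
   pay for the numerical factors 64 and [4 ^ D]. *)
exists (fun k => 2 ^ ((c + 2 + 6 + 2 * D) + F k)), D.
split.
  exact: honest_computable (honest_comp (honest_comp hF (honest_addn _)) honest_exp2).
move=> I; set t := encoding I; set k := parameter I.
have cId : computes (Assign 0 (Var 0)) id (fun=> 2) by exact: computes_assign.
have [n [s [e s0 _ le_n]]] :=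
  computes_comp (computes_node (computes_comp ckD cFD) cId) cAD (init t).
exists n, (s 0); split; first by exists s.
  rewrite s0 /init /update /= kE (fFE k).1; apply: AE.
  by rewrite spine_enc_nat.
apply: leq_trans le_n _; rewrite /init /update /= -/t kE -/k (fFE k).1.
have := Tdk t; have := (fFE k).2; have := TdA (Node (enc_nat (F k)) t).
rewrite /= tsize_enc_nat /input_size -/t; set f := F k.
have t0 : 0 < tsize t by apply: tsize_gt0.
set N := tsize t in t0 *.
have [M MN] : exists M, M = N ^ D * f.+2 ^ D * 2 ^ (2 * D) by eexists.
have base a d : a <= N * f.+2 * 4 -> d <= D -> a ^ d <= M.
  move=> le_a le_d; apply: leq_trans (leq_exp_base d le_a) _.
  apply: leq_trans (leq_exp_exponent (e := D) _ le_d) _; first by rewrite !muln_gt0 t0.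
  by rewrite MN !expnMn expnM.
have h1 : (((f.*2.+1 + N).+1).+1) ^ dA <= M by apply: base; [nia | rewrite /D; lia].
have h2 : f.+2 ^ dF <= M by apply: base; [nia | rewrite /D; lia].
have h3 : N.+1 ^ dk <= M by apply: base; [nia | rewrite /D; lia].
have h4 : 1 <= M by rewrite MN !muln_gt0 !expn_gt0 t0.
have h5 : 64 * M <= 2 ^ (c + 2 + 6 + 2 * D + f) * N ^ D.
  have -> : c + 2 + 6 + 2 * D + f = c + f.+2 + (6 + 2 * D) by lia.
  have := Dc f.+2; rewrite MN [in X in _ -> X]expnD [2 ^ (6 + _)]expnD.
  have -> : 2 ^ 6 = 64 by [].
  move: (2 ^ (c + f.+2)) (2 ^ (2 * D)) (N ^ D) (f.+2 ^ D) => x y z w le.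
  by rewrite [X in _ <= X](_ : _ = 64 * (z * x * y)) ?leq_mul //; lia.
move=> h6 h7 h8.
have : TA (Node (enc_nat f) t) <= M by apply: leq_trans h6 h1.
have : TF (enc_nat k) <= M by apply: leq_trans h7 h2.
have : Tk t <= M by apply: leq_trans h8 h3.
lia.
Qed.

(** The list is its own counter: erasing the entries of the list of the first [j] numbers yields the
    unary [j], which is the next entry. *)
Lemma PT_vertices f : PT f -> PT (fun t => unl [seq enc_nat i | i <- iota 0 (spine (f t))]).
Proof.
move=> Pf.
have E j : iter j (fun l => tcat l (Node (tmap (fun=> Leaf) l) Leaf)) Leaf =
    unl [seq enc_nat i | i <- iota 0 j].
  elim: j => // j IH; rewrite -addn1 iotaD addn1 /= IH map_cat /tcat unlK /=.
  by rewrite tmap_leaf spine_unl size_map size_iota.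
apply: PT_ext (PT_iter (F := fun _ l => tcat l (Node (tmap (fun=> Leaf) l) Leaf))
  (init := fun=> Leaf) (B := fun t => (tsize (f t)) * (2 * tsize (f t) + 2) + 1)
  _ Pf PT_leaf _ _) => [t|||t j le_j].
- by rewrite E.
- apply: PT_cat; first by apply: PT_ttl PT_id.
  apply: PT_node PT_leaf; apply: PT_map; last exact: PT_ttl PT_id.
  exact: PT_leaf.
- have Pb := PT_size Pf; apply: polyb_add (polyb_cst _).
  apply: (polyb_mul Pb); apply: polyb_add (polyb_cst _).
  by apply: polyb_mul (polyb_cst _) Pb.
rewrite E tsize_unl.
have : wsize [seq enc_nat i | i <- iota 0 j] <= j * (2 * j + 2).
  elim: j {le_j} => // j IH; rewrite -{1}[j.+1]addn1 iotaD map_cat wsize_cat /=.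
  by rewrite /wsize /= -/(wsize _) tsize_enc_nat; lia.
have := spine_lt (f t); nia.
Qed.

Ltac pt := repeat match goal with
  | H : PT ?f |- PT ?f => exact H
  | |- PT (fun t => t) => exact: PT_id
  | |- PT thd => exact: (PT_thd PT_id)
  | |- PT ttl => exact: (PT_ttl PT_id)
  | |- PT (fun=> Leaf) => exact: PT_leaf
  | |- PT (fun t => Node _ _) => apply: PT_node
  | |- PT (fun t => thd _) => apply: PT_thd
  | |- PT (fun t => ttl _) => apply: PT_ttl
  | |- PT (fun t => tree_nth _ (spine _)) => apply: PT_nth
  | |- PT (fun t => tcat _ _) => apply: PT_cat
  | |- PT (fun t => tflat _ _) => apply: PT_flat
  | |- PT (fun t => tmap _ _) => apply: PT_map
  | |- PT (fun t => tfilter _ _) => apply: PT_filter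
  | |- PT (fun t => if _ then _ else _) => apply: PT_if
  | |- PT (fun t => enc_bool _) => rewrite -/(PTb _)
  | |- PTb (fun t => _ && _) => apply: PTb_and
  | |- PTb (fun t => _ || _) => apply: PTb_or
  | |- PTb (fun t => _ ==> _) => apply: PTb_imp
  | |- PTb (fun t => ~~ _) => apply: PTb_neg
  | |- PTb (fun t => isn _) => apply: PTb_isn
  | |- PTb (fun t => spine _ == spine _) => apply: PTb_eq
  | |- PTb (fun t => spine _ <= spine _) => apply: PTb_leq
  | |- PTb (fun t => has _ (lst _)) => apply: PTb_has
  | |- PTb (fun t => all _ (lst _)) => apply: PTb_all
  | |- PT2 _ => rewrite /PT2 /=
  | |- PTb2 _ => rewrite /PTb2 /=
  | H : PT ?f |- PT (fun t => ?f _) => apply: (PT_comp H)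
  end.

(** * Layers of a covered graph *)

Section Distance.

Variable G : graph.
Local Notation V := (vertex G).
Implicit Types (x y z : V) (A : {pred V}).

Fixpoint within A (r : nat) x : bool :=
  if r is r'.+1 then [exists y, within A r' y && ((y == x) || adj y x)]
  else x \in A.

(* Capped: the value is [order G] for the vertices that [A] does not reach. *)
Definition dist A x : nat :=
  count (fun r => ~~ within A r x) (iota 0 (order G)).

Definition close (r : nat) x y : bool := within (pred1 x) r y.

Lemma within_succ A r x : within A r.+1 x =
  [exists y, within A r y && ((y == x) || adj y x)].
Proof. by []. Qed.

Lemma withinS A r x : within A r x -> within A r.+1 x.
Proof. by move=> xr; rewrite within_succ; apply/existsP; exists x; rewrite xr eqxx. Qed.

Lemma within_adj A r x y : within A r x -> adj x y -> within A r.+1 y.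
Proof. by move=> xr xy; rewrite within_succ; apply/existsP; exists x; rewrite xr xy orbT. Qed.

Lemma within_mono A r r' x : r <= r' -> within A r x -> within A r' x.
Proof.
move=> le_r; rewrite -(subnKC le_r); elim: (r' - r) => [|j IH] xr; first by rewrite addn0.
by rewrite addnS; apply/withinS/IH.
Qed.

Lemma within_close A r s x y : within A r x -> close s x y -> within A (r + s) y.
Proof.
move=> xr; elim: s y => [|s IH] y; first by rewrite /close /= inE addn0 => /eqP ->.
case/existsP=> z /andP[/IH zr /orP[/eqP <-|zy]]; rewrite addnS; first exact: withinS.
exact: within_adj zr zy.
Qed.

Lemma close_refl x : close 0 x x.
Proof. by rewrite /close /= inE. Qed.

Lemma close_adj x y : adj x y -> close 1 x y.
Proof. exact: within_adj (close_refl x). Qed.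

Lemma close_trans r s x y z : close r x y -> close s y z -> close (r + s) x z.
Proof. exact: within_close. Qed.

Lemma close_sym r x y : close r x y -> close r y x.
Proof.
elim: r y => [|r IH] y; first by rewrite /close /= !inE eq_sym.
case/existsP=> z /andP[/IH zx /orP[/eqP <-|zy]]; first exact: withinS.
rewrite -add1n; apply: close_trans zx; apply: close_adj.
by rewrite adj_sym.
Qed.

Lemma close_mono r r' x y : r <= r' -> close r x y -> close r' x y.
Proof. exact: within_mono. Qed.

(** Being within [r] is monotone in [r], so the radii counted by [dist] form an initial segment,
    whose length is the first radius that succeeds. *)
Lemma dist_leq A r x : r < order G -> within A r x = (dist A x <= r).
Proof.
move=> r_lt; have split_iota m : m <= order G ->
    dist A x = count (fun r => ~~ within A r x) (iota 0 m) +
               count (fun r => ~~ within A r x) (iota m (order G - m)).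
  by move=> le_m; rewrite -count_cat -{2}[m]add0n -iotaD subnKC.
case xr: (within A r x).
  rewrite (split_iota r (ltnW r_lt)) (_ : count _ (iota r _) = 0).
    by rewrite addn0 -[X in _ <= X](size_iota 0 r) count_size.
  apply/eqP; rewrite -leqn0 leqNgt -has_count; apply/negP => /hasP[j].
  by rewrite mem_iota => /andP[rj _]; rewrite (within_mono rj xr).
apply/esym/negbTE; rewrite -ltnNge (split_iota r.+1 r_lt).
apply: leq_trans (leq_addr _ _).
rewrite -{1}(size_iota 0 r.+1) -[X in X <= _]count_predT.
rewrite leq_eqVlt; apply/orP; left; apply/eqP/eq_in_count => j.
rewrite mem_iota add0n ltnS /= => jr; apply/esym/negP => /(within_mono jr).
by rewrite xr.
Qed.

Lemma dist_le_order A x : dist A x <= order G.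
Proof. by rewrite -[X in _ <= X](size_iota 0) count_size. Qed.

Lemma dist_close A r x y : close r x y -> dist A y <= dist A x + r.
Proof.
move=> xy; have [lt|ge] := ltnP (dist A x + r) (order G); last first.
  exact: leq_trans (dist_le_order A y) ge.
rewrite -dist_leq //; apply: within_close xy; rewrite dist_leq //.
by apply: leq_ltn_trans lt; apply: leq_addr.
Qed.

(** A walk of length [dist A x] from [A] to [x]; no [v j] can be nearer to [A] than [j], since this
    would shorten the way to [x]. The hypothesis says that the cap is not attained. *)
Lemma geodesic A x : dist A x < order G ->
  exists v : nat -> V, [/\ v 0 \in A, v (dist A x) = x,
    (forall i j, i <= j -> j <= dist A x -> close (j - i) (v i) (v j)) &
    forall j, j <= dist A x -> dist A (v j) = j].
Proof.
move=> x_lt; set D := dist A x.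
have walk m y : within A m y -> exists v : nat -> V, [/\ v 0 \in A, v m = y &
    forall j, j < m -> close 1 (v j) (v j.+1)].
  elim: m y => [|m IH] z; first by exists (fun=> z).
  case/existsP=> y /andP[/IH[v [v0 vD v_close]] yz].
  exists (fun j => if j == m.+1 then z else v j); rewrite eqxx; split=> // j.
  rewrite ltnS eqSS => le_j; rewrite ltn_eqF //.
  case: eqVneq => [->|ne_j]; last by apply: v_close; rewrite ltn_neqAle ne_j.
  rewrite vD; case/orP: yz => [/eqP <-|]; last exact: close_adj.
  exact: close_mono (close_refl y).
have [|v [v0 vD v_close]] := walk D x; first by rewrite dist_leq.
have v_close2 i j : i <= j -> j <= D -> close (j - i) (v i) (v j).
  move=> le_ij; rewrite -(subnKC le_ij) addKn; elim: (j - i) => [|m IH] le_m.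
    by rewrite addn0 close_refl.
  rewrite addnS -addn1; apply: close_trans (IH _) _; first by lia.
  by apply: v_close; lia.
exists v; split=> // j le_j; apply/eqP; rewrite eqn_leq -dist_leq; last by lia.
rewrite -{1}(subn0 j) -[j - 0]add0n.
rewrite (within_close (x := v 0)) ?v_close2 //=.
have := dist_close A (v_close2 j D le_j (leqnn D)).
by rewrite vD -/D; lia.
Qed.

Lemma path_close x p : path (@adj G) x p -> close (size p) x (last x p).
Proof.
elim: p x => [|y p IH] x /=; first by rewrite close_refl.
by case/andP=> xy /IH; rewrite -add1n; apply: close_trans; apply: close_adj.
Qed.

Lemma close_path r x y : close r x y ->
  exists p, [/\ path (@adj G) x p, last x p = y & size p <= r].
Proof.
elim: r y => [|r IH] y; first by rewrite /close /= inE => /eqP ->; exists [::].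
case/existsP=> z /andP[/IH[p [xp zp le_p]] /orP[/eqP <-|zy]].
  by exists p; split=> //; apply: leqW.
by exists (rcons p y); rewrite rcons_path xp zp zy last_rcons size_rcons.
Qed.

(** * Isometry of shortest paths *)

Section ShortestPath.

Variables (s t : V) (p : seq V).
Hypothesis p_shortest : shortest_path s t p.

Lemma shortest_size r : close r s t -> size p <= r.+1.
Proof.
case/close_path=> q []; case/shortenP=> q' sq' uq' sub_q' qt le_q.
case: p_shortest => _ min_p.
apply: leq_trans (min_p (s :: q') _) _; first by rewrite /= eqxx sq' qt eqxx.
rewrite /= ltnS; apply: leq_trans le_q; apply: uniq_leq_size sub_q'.
by case/andP: uq'.
Qed.

Lemma shortest_head : s \in p.
Proof. by case: p_shortest; case: p => //= x q /and4P[/eqP ->]; rewrite inE eqxx. Qed.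

Lemma shortest_uniq : uniq p.
Proof. by case: p_shortest; case: p => //= x q /and4P[]. Qed.

Lemma shortest_adj j : j.+1 < size p -> adj (nth s p j) (nth s p j.+1).
Proof.
case: p_shortest => + _; case: p => //= x q /and4P[_ /(pathP s) xq _ _].
by rewrite ltnS => /xq.
Qed.

Lemma shortest_close i j : i <= j -> j < size p -> close (j - i) (nth s p i) (nth s p j).
Proof.
move=> le_ij; rewrite -(subnKC le_ij) addKn; elim: (j - i) => [|m IH] lt_m.
  by rewrite addn0 close_refl.
rewrite addnS -addn1; apply: close_trans (IH _) _; first by lia.
by apply/close_adj/shortest_adj; lia.
Qed.

Lemma shortest_first : nth s p 0 = s.
Proof. by case: p_shortest; case: p => //= x q /and4P[/eqP]. Qed.

Lemma shortest_last : nth s p (size p).-1 = t.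
Proof.
case: p_shortest; case: p => // x q /and4P[_ _ /eqP <- _] _.
by rewrite nth_last.
Qed.

(** A walk from [s] to [x], continued along [p] from [x] to [t], cannot have fewer steps than
    [p]. *)
Lemma index_close x r : x \in p -> close r s x -> index x p <= r.
Proof.
move=> xp sx; have lt_x : index x p < size p by rewrite index_mem.
have xt : close ((size p).-1 - index x p) x t.
  have := @shortest_close (index x p) (size p).-1.
  by rewrite nth_index // shortest_last; apply; lia.
by have := shortest_size (close_trans sx xt); lia.
Qed.

Lemma index_lt_order x : x \in p -> index x p < order G.
Proof.
move=> xp; apply: (@leq_trans (size p)); first by rewrite index_mem.
by rewrite -(card_ord (order G)) -(card_uniqP shortest_uniq) max_card.
Qed.

Lemma shortest_dist x : x \in p -> dist (pred1 s) x = index x p.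
Proof.
move=> xp; have lt_x : index x p < size p by rewrite index_mem.
have sx : close (index x p) s x.
  by have := shortest_close (leq0n _) lt_x; rewrite subn0 nth_index // shortest_first.
have lt_n := index_lt_order xp.
have le_i : dist (pred1 s) x <= index x p by rewrite -dist_leq.
apply/eqP; rewrite eqn_leq le_i /=; apply: index_close => //.
by rewrite /close dist_leq //; apply: leq_ltn_trans lt_n.
Qed.

Lemma index_isometry x y r : x \in p -> y \in p -> close r x y ->
  index y p <= index x p + r.
Proof.
move=> xp yp xy; apply: index_close => //; apply: close_trans xy.
have := shortest_close (leq0n _) (_ : index x p < size p).
by rewrite subn0 nth_index // shortest_first index_mem; apply.
Qed.

Lemma index_geodesic x y : x \in p -> y \in p ->
  close (index y p - index x p + (index x p - index y p)) x y.
Proof.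
move=> xp yp; wlog le_xy: x y xp yp / index x p <= index y p.
  move=> IH; case/orP: (leq_total (index x p) (index y p)) => /IH; first exact.
  by move=> /(_ yp xp); rewrite addnC => /close_sym.
have := shortest_close le_xy; rewrite index_mem !nth_index // => /(_ yp).
by apply: close_mono; lia.
Qed.

End ShortestPath.
End Distance.

(** * Radial sets and the size of layers *)

Section Cover.

Variables (G : graph) (k : nat).
Local Notation V := (vertex G).
Variables (s t : 'I_k -> V) (P : 'I_k -> seq V).
Hypothesis P_shortest : forall i, shortest_path (s i) (t i) (P i).
Hypothesis P_cover : forall x, exists i, x \in P i.

Definition sources : seq V := [seq s i | i <- enum 'I_k].
Definition source_dist (x : V) : nat := dist (mem sources) x.
Local Notation delta := source_dist.
Definition pos (i : 'I_k) (x : V) : nat := index x (P i).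

Lemma delta_lt x : delta x < order G.
Proof.
have [i xi] := P_cover x.
have x_lt := index_lt_order (P_shortest i) xi.
apply: leq_ltn_trans (x_lt); rewrite /source_dist -dist_leq //.
apply: (@within_close _ _ 0 _ (s i)); first by apply: map_f; rewrite mem_enum.
have := index_geodesic (P_shortest i) (shortest_head (P_shortest i)) xi.
apply: close_mono; suff -> : index (s i) (P i) = 0 by rewrite subn0 sub0n addn0.
apply/eqP; rewrite -leqn0; apply: index_close (close_refl _) => //.
exact: shortest_head.
Qed.

Lemma delta_close r x y : close r x y -> delta y <= delta x + r.
Proof. exact: dist_close. Qed.

Lemma delta_geodesic x : exists v : nat -> V, [/\ v 0 \in sources, v (delta x) = x,
    (forall i j, i <= j -> j <= delta x -> close (j - i) (v i) (v j)) &
    forall j, j <= delta x -> delta (v j) = j].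
Proof. exact: geodesic (delta_lt x). Qed.

(* A radial set contains at most one vertex at each distance from the sources. *)
Definition radial (U : {set V}) : Prop :=
  {in U &, forall u u', delta u <= delta u' -> close (delta u' - delta u) u u'}.

Definition radial_cover (n : nat) (A : V -> Prop) : Prop :=
  exists L : seq {set V}, [/\ size L <= n, {in L, forall U, radial U} &
    forall x, A x -> exists2 U, U \in L & x \in U].

Lemma radial_cover_sub n A B :
  (forall x, A x -> B x) -> radial_cover n B -> radial_cover n A.
Proof. by move=> AB [L [? ? LB]]; exists L; split=> // x /AB/LB. Qed.

Lemma radial_cover_bigU (T : eqType) (r : seq T) m (A : T -> V -> Prop) :
  {in r, forall a, radial_cover m (A a)} ->
  radial_cover (size r * m) (fun x => exists2 a, a \in r & A a x).
Proof.
elim: r => [|a r IH] Ar; first by exists [::]; split=> // x [].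
have [|L [L_le L_rad LA]] := IH; first by move=> b br; apply: Ar; rewrite inE br orbT.
have [L' [L'_le L'_rad L'A]] := Ar a (mem_head _ _).
exists (L' ++ L); split.
- by rewrite size_cat mulSn leq_add.
- by move=> U; rewrite mem_cat => /orP[/L'_rad|/L_rad].
move=> x [b]; rewrite inE => /orP[/eqP ->|br] Abx.
  by have [U UL' xU] := L'A x Abx; exists U; rewrite // mem_cat UL'.
have [U UL xU] := LA x (ex_intro2 _ _ b br Abx).
by exists U; rewrite // mem_cat UL orbT.
Qed.

(** An absolute difference, written as a sum of truncated subtractions. For vertices of [P i] it is
    their distance in the graph. *)
Definition gap i x y : nat := pos i x - pos i y + (pos i y - pos i x).

(* The points that a geodesic from the sources reaches along the path [P i],
   once it has entered that path from a point of [U]. *)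
Definition reached i (U : V -> Prop) x : Prop :=
  x \in P i /\ exists u w, [/\ U u, w \in P i, close 1 u w & delta x = delta w + gap i x w].

Lemma delta_gap i x y : x \in P i -> y \in P i -> delta x <= delta y + gap i x y.
Proof.
move=> xi yi; apply: delta_close; have := index_geodesic (P_shortest i) yi xi.
by apply: close_mono; rewrite /gap.
Qed.

Lemma gap_close i r x y : x \in P i -> y \in P i -> close r x y -> gap i x y <= r.
Proof.
move=> xi yi xy; have := index_isometry (P_shortest i) xi yi xy.
have := index_isometry (P_shortest i) yi xi (close_sym xy); rewrite /gap /pos; lia.
Qed.

(** The part of [P i] on which [pos i - delta] has its value at [y], with the subtraction cleared;
    [line_down] does the same for [pos i + delta]. On either line a difference of positions is a
    difference of [delta], so both are radial. *)
Definition line_up i y : {set V} :=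
  [set x | (x \in P i) && (pos i x + delta y == pos i y + delta x)].

Definition line_down i y : {set V} :=
  [set x | (x \in P i) && (pos i x + delta x == pos i y + delta y)].

Lemma close_gap i x y r : x \in P i -> y \in P i -> gap i x y <= r -> close r x y.
Proof.
move=> xi yi le_r; apply: close_mono le_r _.
by have := index_geodesic (P_shortest i) xi yi; rewrite /gap addnC.
Qed.

Lemma radial_line_up i y : radial (line_up i y).
Proof.
move=> x z; rewrite !inE => /andP[xi /eqP x_line] /andP[zi /eqP z_line] le_xz.
by apply: (close_gap xi zi); rewrite /gap; lia.
Qed.

Lemma radial_line_down i y : radial (line_down i y).
Proof.
move=> x z; rewrite !inE => /andP[xi /eqP x_line] /andP[zi /eqP z_line] le_xz.
by apply: (close_gap xi zi); rewrite /gap; lia.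
Qed.

(* If [pos - delta] or [pos + delta] is constant on [C], every vertex reached
   from [C] along [P i] lies on one of the two lines through the element of [C]
   closest to the sources: turning back from a later element would meet the
   line again and be shorter. *)
Lemma reached_from_line i (C : pred V) :
  (forall w, C w -> w \in P i) ->
  (forall w w', C w -> C w' -> pos i w + delta w' = pos i w' + delta w) \/
  (forall w w', C w -> C w' -> pos i w + delta w = pos i w' + delta w') ->
  radial_cover 2 (fun x => x \in P i /\
    exists2 w, C w & delta x = delta w + gap i x w).
Proof.
move=> Ci C_line; have [w0 Cw0|C0] := pickP C; last first.
  by exists [::]; split=> // x [_ [w]]; rewrite C0.
have [w1 Cw1 w1_min] := arg_minnP (fun w => delta w) Cw0.
exists [:: line_up i w1; line_down i w1]; split=> //.
  move=> U; rewrite !inE => /orP[] /eqP ->.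
    exact: radial_line_up.
  exact: radial_line_down.
move=> x [xi [w Cw dx]]; have := delta_gap xi (Ci _ Cw1); have := w1_min w Cw.
case: C_line => /(_ w w1 Cw Cw1) w_line le1 le2; move: dx le2; rewrite /gap => dx le2.
  case: (leqP (pos i w) (pos i x)) => le_x.
    by exists (line_up i w1); rewrite !inE ?eqxx // xi; apply/eqP; lia.
  by exists (line_down i w1); rewrite !inE ?eqxx ?orbT // xi; apply/eqP; lia.
case: (leqP (pos i x) (pos i w)) => le_x.
  by exists (line_down i w1); rewrite !inE ?eqxx ?orbT // xi; apply/eqP; lia.
by exists (line_up i w1); rewrite !inE ?eqxx // xi; apply/eqP; lia.
Qed.

(** Let [W] be the possible points of entry into [P i] and [w1] one with least [delta]. For [w] in
    [W], the excess of [gap i w w1] over [delta w - delta w1] is between 0 and 4, and [w] lies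
    before or after [w1] on the path. This gives ten classes [C], on each of which [pos i - delta]
    or [pos i + delta] is constant, and [reached_from_line] provides two lines for each: 20 in
    all. *)
Lemma reached_cover i (U : {set V}) :
  radial U -> radial_cover 20 (reached i (fun u => u \in U)).
Proof.
move=> U_rad; pose W w := (w \in P i) && [exists u in U, close 1 u w].
have [w0 Ww0|W0] := pickP W; last first.
  exists [::]; split=> // x [_ [u [w [uU wi uw _]]]]; have := W0 w.
  by rewrite /W wi; case/existsP; exists u; rewrite uU.
have [w1 Ww1 w1_min] := arg_minnP (fun w => delta w) Ww0.
pose C (a : bool * nat) w := W w &&
  (if a.1 then pos i w + delta w1 == pos i w1 + delta w + a.2
   else pos i w + delta w + a.2 == pos i w1 + delta w1).
pose r := [seq (b, e) | b <- [:: true; false], e <- iota 0 5].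
have := @radial_cover_bigU _ r 2 (fun a x => x \in P i /\
  exists2 w, C a w & delta x = delta w + gap i x w).
move/(_ _)/radial_cover_sub; apply; last first.
  move=> [b e] _; apply: (reached_from_line (C := C (b, e))) => [w /andP[/andP[]] //|].
  case: b; [left | right] => w w' /andP[_ /eqP /= e1] /andP[_ /eqP /= e2]; lia.
move=> x [xi [u [w [uU wi uw dx]]]].
have Ww : W w by rewrite /W wi; apply/existsP; exists u; rewrite uU.
have le1 := w1_min w Ww.
have [w1i /existsP[u1 /andP[u1U u1w1]]] := andP Ww1.
(* Passing from [w] to [w1] through [u] and [u1] costs two extra steps; two more come from [delta],
   which changes by at most one between [u] and [w] and between [u1] and [w1]. *)
have le_gap : gap i w w1 <= delta w - delta w1 + 4.
  have duw := delta_close uw.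
  have dwu := delta_close (close_sym uw).
  have du1w1 := delta_close u1w1.
  have dw1u1 := delta_close (close_sym u1w1).
  apply: gap_close => //.
  have uu1 : close (delta w - delta w1 + 2) u u1.
    case: (leqP (delta u) (delta u1)) => [le_u|/ltnW le_u].
      by apply: close_mono (U_rad u u1 uU u1U le_u); clear -dwu dw1u1 duw du1w1 le1; lia.
    by apply/close_sym/(close_mono _ (U_rad u1 u u1U uU le_u)); clear -dwu dw1u1 duw du1w1 le1; lia.
  have := close_trans (close_trans (close_sym uw) uu1) u1w1.
  by apply: close_mono; clear; lia.
have ge_gap := delta_gap wi w1i.
case: (leqP (pos i w1) (pos i w)) => le_pos.
  exists (true, gap i w w1 - (delta w - delta w1)).
    by apply: allpairs_f => //; rewrite mem_iota; clear -le_gap; lia.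
  split=> //; exists w => //; rewrite /C Ww /=; move: ge_gap; rewrite /gap.
  by clear -le1 le_pos => ?; apply/eqP; lia.
exists (false, gap i w w1 - (delta w - delta w1)).
  by apply: allpairs_f => //; rewrite mem_iota; clear -le_gap; lia.
split=> //; exists w => //; rewrite /C Ww /=; move: ge_gap; rewrite /gap.
by clear -le1 le_pos => ?; apply/eqP; lia.
Qed.

Fixpoint segments (l : nat) x : Prop :=
  if l is l'.+1 then exists i, reached i (segments l') x else x \in sources.

(** The sources are [k] singletons, and one more piece, along any of [k] paths, replaces each radial
    set by at most [k * 20]. *)
Lemma segments_cover l : radial_cover (k * (k * 20) ^ l) (segments l).
Proof.
elim: l => [|l [L [L_le L_rad LS]]].
  exists [seq [set s i] | i <- enum 'I_k]; split.
  - by rewrite size_map size_enum_ord expn0 muln1.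
  - move=> _ /mapP[i _ ->] u u'; rewrite !inE => /eqP -> /eqP -> _.
    by rewrite subnn close_refl.
  by move=> _ /mapP[i i_in ->]; exists [set s i]; rewrite ?inE //; apply/mapP; exists i.
have L_cover : {in enum 'I_k, forall i, radial_cover (size L * 20)
    (fun x => exists2 U : {set V}, U \in L & reached i (fun u => u \in U) x)}.
  move=> i _; apply: (radial_cover_bigU (A := fun (U : {set V}) => reached i (fun u => u \in U))).
  by move=> U /L_rad; apply: reached_cover.
have [L' [L'_le L'_rad L'S]] := radial_cover_bigU L_cover.
exists L'; split=> //.
  apply: leq_trans L'_le _; rewrite size_enum_ord expnS.
  move: L_le; set Z := (k * 20) ^ l; nia.
move=> x [i [xi [u [w [/LS[U UL uU] wi uw dx]]]]]; apply: L'S.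
by exists i; rewrite ?mem_enum //; exists U => //; split=> //; exists u, w.
Qed.

Lemma segmentsS l x : segments l x -> segments l.+1 x.
Proof.
move=> lx; have [i xi] := P_cover x; exists i; split=> //; exists x, x; split=> //.
  exact: close_mono (close_refl x).
by rewrite /gap; lia.
Qed.

Lemma segments_mono l m x : l <= m -> segments l x -> segments m x.
Proof.
move=> le_lm; rewrite -(subnKC le_lm); elim: (m - l) => [|j IH] lx; first by rewrite addn0.
by rewrite addnS; apply/segmentsS/IH.
Qed.

(* A geodesic is cut after its last vertex on the path of its first vertex; the
   rest avoids that path, so that at most [k] pieces arise. *)
Lemma segments_all x : segments k x.
Proof.
have [v [v0 vD v_close v_delta]] := delta_geodesic x; set D := delta x in vD v_close v_delta *.
(* [C] holds the paths that the rest of the geodesic may still use, and its size bounds the number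
   of pieces to come. *)
suff main m : forall l (C : {set 'I_k}) j, #|C| = m -> j <= D ->
    (forall j', j <= j' -> j' <= D -> exists2 i, i \in C & v j' \in P i) ->
    (exists2 u, segments l u & close 1 u (v j)) -> segments (l + m) (v D).
  rewrite -vD -{1}(card_ord k) -cardsT -[#|_|]add0n; apply: (main _ 0 setT 0) => //.
    by move=> j' _ _; have [i ?] := P_cover (v j'); exists i; rewrite ?inE.
  by exists (v 0) => //; apply: close_mono (close_refl _).
elim: m => [|m IH] l C j C_card le_j C_cover [u lu uv].
  have [i] := C_cover j (leqnn j) le_j.
  by rewrite (cards0_eq C_card) inE.
have [i iC vj_i] := C_cover j (leqnn j) le_j.
pose Q j' := [&& j <= j', j' <= D & v j' \in P i].
have Qj : exists j', Q j' by exists j; rewrite /Q leqnn le_j.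
have Q_le j' : Q j' -> j' <= D by case/and3P.
case: (ex_maxnP Qj Q_le) => j1 /and3P[le_jj1 le_j1 vj1_i] j1_max.
have seg1 : segments l.+1 (v j1).
  exists i; split=> //; exists u, (v j); split=> //.
  rewrite !v_delta //; have := gap_close vj1_i vj_i (close_sym (v_close _ _ le_jj1 le_j1)).
  by have := delta_gap vj1_i vj_i; rewrite !v_delta //; lia.
case: (ltngtP j1 D) le_j1 => // [lt_j1|eq_j1] _; last first.
  by rewrite -eq_j1; apply: segments_mono seg1; lia.
rewrite addnS -addSn; apply: (IH _ (C :\ i) j1.+1) => //.
- by move: C_card; rewrite (cardsD1 i) iC => -[].
- move=> j' lt_j' le_j'; have [i' i'C vj'_i'] := C_cover j' (leq_trans (leqW le_jj1) lt_j') le_j'.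
  exists i' => //; rewrite !inE i'C andbT; apply/eqP => i'i.
  have := j1_max j'; rewrite /Q le_j' -i'i vj'_i' !andbT => /(_ _); lia.
- by exists (v j1) => //; have := v_close _ _ (leqnSn j1) lt_j1; rewrite subSnn.
Qed.

Lemma layer_bound d : #|[set x | delta x == d]| <= k * (k * 20) ^ k.
Proof.
have [L [L_le L_rad LS]] := segments_cover k.
apply: leq_trans L_le; have : [set x | delta x == d] \subset
    [set x | (delta x == d) && has (fun U : {set V} => x \in U) L].
  apply/subsetP=> x; rewrite !inE => ->.
  by have [U UL xU] := LS x (segments_all x); apply/hasP; exists U.
move/subset_leq_card/leq_trans; apply; elim: L L_rad {LS} => [|U L IH] L_rad.
  by rewrite leqn0 cards_eq0; apply/eqP/setP => x; rewrite !inE andbF.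
pose A := [set x in U | delta x == d].
apply: (@leq_trans #|A :|: [set x | (delta x == d) && has (fun U : {set V} => x \in U) L]|).
  apply/subset_leq_card/subsetP => x; rewrite !inE /=.
  by case: eqP; rewrite ?andbT ?andbF.
apply: leq_trans (leq_card_setU _ _) _; rewrite /= -add1n leq_add //; last first.
  by apply: IH => W WL; apply: L_rad; rewrite inE WL orbT.
apply/card_le1_eqP=> x y; rewrite !inE => /andP[xU /eqP dx] /andP[yU /eqP dy].
have := L_rad U (mem_head _ _) y x yU xU; rewrite dx dy leqnn subnn => /(_ isT).
by rewrite /close /= inE => /eqP.
Qed.

End Cover.

(** * The algorithm *)

(* Vertices and path indices are unary numbers, compared through [spine].  The
   tree [Node v i] says that vertex [v] lies on path [i]; a state of the search
   is a layer number together with a list of such items for a window. *)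
Definition verts (g : tree) : tree := unl [seq enc_nat i | i <- iota 0 (spine g)].

Definition adjT g u v : bool := isn (tree_nth (tree_nth g (spine u)) (spine v)).

Definition memT u b : bool := has (fun w => spine w == spine u) (lst b).

Definition nextT g b : tree :=
  tfilter (fun v => has (fun u => (spine u == spine v) || adjT g u v) (lst b)) (verts g).

Definition ballT g b r : tree := iter (spine r) (nextT g) b.

(** A number is a list of that length, here the list of the radii counted by [dist]; [verts g]
    serves as the list of radii below the order. *)
Definition distT g b v : tree := tfilter (fun r => ~~ memT v (ballT g b r)) (verts g).

(** Here and below, [Node Leaf] is the successor of a unary number. *)
Definition childT g b u v : bool :=
  adjT g u v && (spine (distT g b v) == spine (Node Leaf (distT g b u))).

Definition srcT ps i : tree := thd (tree_nth ps (spine i)).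
Definition snkT ps i : tree := ttl (tree_nth ps (spine i)).
Definition deltaT g ps v : tree := distT g (tmap thd ps) v.

Definition nearT g ps r v : bool :=
  (spine (deltaT g ps v) <= spine (Node Leaf r)) &&
  (spine r <= spine (Node Leaf (deltaT g ps v))).

Definition windowT g ps r : tree :=
  tflat (fun v => if nearT g ps r v then tmap (fun i => Node v i) (verts ps) else Leaf)
        (verts g).

Definition memI z f : bool :=
  has (fun y => (spine (thd y) == spine (thd z)) && (spine (ttl y) == spine (ttl z))) (lst f).

(* The list of subsets stops growing when it would exceed [pad], which keeps the
   algorithm polynomial; it is complete as soon as [2 ^ spine l <= spine pad]. *)
Definition subsets_step pad acc x : tree :=
  if spine (tcat acc (tmap (fun f => Node x f) acc)) <= spine pad
  then tcat acc (tmap (fun f => Node x f) acc) else acc.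

Definition subsetsT pad l : tree := foldl (subsets_step pad) (Node Leaf Leaf) (lst l).

(** The number of children is compared with an encoded Boolean, whose spine is 0 or 1: none at the
    sink, exactly one elsewhere. *)
Definition ok_itemT g ps f z : bool :=
  ((spine (thd z) == spine (srcT ps (ttl z))) ||
   has (fun y => (spine (ttl y) == spine (ttl z)) &&
          childT g (Node (srcT ps (ttl z)) Leaf) (thd y) (thd z)) (lst f)) &&
  (spine (tfilter (fun y => (spine (ttl y) == spine (ttl z)) &&
          childT g (Node (srcT ps (ttl z)) Leaf) (thd z) (thd y)) f) ==
   spine (enc_bool (~~ (spine (thd z) == spine (snkT ps (ttl z)))))).

(** Only the middle layer [r] is tested: the neighbours of its vertices all lie in the window, those
    of the outer layers may not. *)
Definition okT g ps r f : bool :=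
  [&& all (fun v => (spine (deltaT g ps v) == spine r) ==>
             has (fun z => spine (thd z) == spine v) (lst f)) (lst (verts g)),
      all (fun i => (spine (deltaT g ps (srcT ps i)) == spine r) ==>
             memI (Node (srcT ps i) i) f) (lst (verts ps)) &
      all (fun z => (spine (deltaT g ps (thd z)) == spine r) ==> ok_itemT g ps f z) (lst f)].

(** With [n] the order of the graph, the layer number takes the [n.+1] values from 0 to [n]. A walk
    of [n] transitions, each raising it by one, must therefore start at layer 0, so that no initial
    state has to be prescribed. *)
Definition nodesT pad g ps : tree :=
  tflat (fun r => tfilter (fun x => okT g ps (thd x) (ttl x))
                   (tmap (fun f => Node r f) (subsetsT pad (windowT g ps r))))
        (verts (Node Leaf g)).

Definition transT g ps y x : bool :=
  [&& spine (thd x) == spine (Node Leaf (thd y)),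
      all (fun z => nearT g ps (thd y) (thd z) ==> memI z (ttl y)) (lst (ttl x)) &
      all (fun z => nearT g ps (thd x) (thd z) ==> memI z (ttl x)) (lst (ttl y))].

Definition walk_step pad g ps R : tree :=
  tfilter (fun x => has (fun y => transT g ps y x) (lst R)) (nodesT pad g ps).

Definition walkT pad g ps : tree := iter (spine g) (walk_step pad g ps) (nodesT pad g ps).

(** The second test rejects graphs with a vertex out of reach of the sources, where [delta] is only
    the cap; by [delta_lt] a covered graph passes it. *)
Definition coverT t : tree :=
  enc_bool (isn (walkT (thd t) (thd (ttl t)) (ttl (ttl t))) &&
    all (fun v => spine (Node Leaf (deltaT (thd (ttl t)) (ttl (ttl t)) v)) <= spine (thd (ttl t)))
        (lst (verts (thd (ttl t))))).

Arguments verts : simpl never.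
Arguments ballT : simpl never.
Arguments distT : simpl never.
Arguments deltaT : simpl never.
Arguments nearT : simpl never.
Arguments windowT : simpl never.
Arguments subsetsT : simpl never.
Arguments okT : simpl never.
Arguments nodesT : simpl never.
Arguments transT : simpl never.
Arguments walkT : simpl never.

(** * Polynomial time of the tests and of the search *)

Lemma tsize_filter p l : tsize (tfilter p l) <= tsize l.
Proof.
rewrite -[in X in _ <= X](lstK l) !tsize_unl ltnS.
elim: (lst l) => //= x s IH; rewrite /wsize /= in IH *; case: ifP => _ /=; lia.
Qed.

Lemma PT_verts f : PT f -> PT (fun t => verts (f t)).
Proof. exact: PT_vertices. Qed.

Lemma PTb_adjT f u v : PT f -> PT u -> PT v -> PTb (fun t => adjT (f t) (u t) (v t)).
Proof. by move=> Pf Pu Pv; rewrite /adjT; pt. Qed.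

Lemma PTb_memT u b : PT u -> PT b -> PTb (fun t => memT (u t) (b t)).
Proof. by move=> Pu Pb; rewrite /memT; pt. Qed.

Lemma PT_nextT g b : PT g -> PT b -> PT (fun t => nextT (g t) (b t)).
Proof. by move=> Pg Pb; rewrite /nextT; do !(pt || apply: PT_verts || apply: PTb_adjT). Qed.

(** Values cannot grow, because every step returns a sublist of the list of all vertices. *)
Lemma PT_ballT g b r : PT g -> PT b -> PT r -> PT (fun t => ballT (g t) (b t) (r t)).
Proof.
move=> Pg Pb Pr.
apply: (PT_iter (F := fun t => nextT (g t))
  (B := fun t => tsize (verts (g t)) + tsize (b t))) => //.
- by apply: PT_nextT; pt.
- by apply: polyb_add; [apply/PT_size/PT_verts | apply/PT_size].
move=> t [|j] _ /=; first exact: leq_addl.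
by apply: leq_trans (leq_addr _ _); apply: tsize_filter.
Qed.

Lemma PT_distT g b v : PT g -> PT b -> PT v -> PT (fun t => distT (g t) (b t) (v t)).
Proof.
by move=> Pg Pb Pv; rewrite /distT;
  do !(pt || apply: PT_verts || apply: PTb_memT || apply: PT_ballT).
Qed.

Lemma PTb_childT g b u v : PT g -> PT b -> PT u -> PT v ->
  PTb (fun t => childT (g t) (b t) (u t) (v t)).
Proof. by move=> *; rewrite /childT; do !(pt || apply: PTb_adjT || apply: PT_distT). Qed.

Lemma PT_srcT ps i : PT ps -> PT i -> PT (fun t => srcT (ps t) (i t)).
Proof. by move=> *; rewrite /srcT; pt. Qed.

Lemma PT_snkT ps i : PT ps -> PT i -> PT (fun t => snkT (ps t) (i t)).
Proof. by move=> *; rewrite /snkT; pt. Qed.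

Lemma PT_deltaT g ps v : PT g -> PT ps -> PT v -> PT (fun t => deltaT (g t) (ps t) (v t)).
Proof. by move=> *; rewrite /deltaT; do !(pt || apply: PT_distT). Qed.

Lemma PTb_nearT g ps r v : PT g -> PT ps -> PT r -> PT v ->
  PTb (fun t => nearT (g t) (ps t) (r t) (v t)).
Proof. by move=> *; rewrite /nearT; do !(pt || apply: PT_deltaT). Qed.

Lemma PT_windowT g ps r : PT g -> PT ps -> PT r -> PT (fun t => windowT (g t) (ps t) (r t)).
Proof. by move=> *; rewrite /windowT; do !(pt || apply: PTb_nearT || apply: PT_verts). Qed.

Lemma PTb_memI z f : PT z -> PT f -> PTb (fun t => memI (z t) (f t)).
Proof. by move=> *; rewrite /memI; pt. Qed.

(** The successor of [spine pad] allows for the initial list, which has one element even if the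
    padding is empty. *)
Lemma subsets_step_bound pad acc x m :
  spine acc <= (spine pad).+1 -> all (fun f => tsize f <= m) (lst acc) ->
  spine (subsets_step pad acc x) <= (spine pad).+1 /\
  all (fun f => tsize f <= m + (tsize x).+1) (lst (subsets_step pad acc x)).
Proof.
move=> acc_le acc_m; rewrite /subsets_step; case: ifP => le_pad.
  split; first exact: leqW.
  rewrite /tcat /tmap !unlK all_cat all_map; apply/andP; split.
    by apply: sub_all acc_m => f /=; lia.
  by apply: sub_all acc_m => f /=; lia.
by split=> //; apply: sub_all acc_m => f /=; lia.
Qed.

Lemma wsize_le l m : all (fun f => tsize f <= m) l -> wsize l <= size l * m.+1.
Proof.
elim: l => //= x l IH /andP[x_le /IH]; rewrite /wsize /= mulSn; lia.
Qed.

Lemma PT_subsetsT pad l : PT pad -> PT l -> PT (fun t => subsetsT (pad t) (l t)).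
Proof.
move=> Ppad Pl.
apply: (PT_foldl (F := fun t => subsets_step (pad t)) (init := fun=> Node Leaf Leaf)
  (B := fun t => (tsize (pad t) + 1) * (tsize (l t) + 2) + 1)) => //.
- by rewrite /subsets_step; pt.
- by pt.
- have Pb := PT_size Ppad; have Lb := PT_size Pl.
  apply: polyb_add (polyb_cst _).
  by apply: polyb_mul; apply: polyb_add (polyb_cst _).
move=> t j; set s := take _ _.
have [acc_le acc_m] :
    spine (foldl (subsets_step (pad t)) (Node Leaf Leaf) s) <= (spine (pad t)).+1 /\
    all (fun f => tsize f <= 1 + wsize s) (lst (foldl (subsets_step (pad t)) (Node Leaf Leaf) s)).
  elim/last_ind: s => [|s x [IHle IHm]]; first by [].
  have wx : wsize (rcons s x) = wsize s + (tsize x).+1.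
    by rewrite -cats1 wsize_cat /wsize /= addn0.
  rewrite -cats1 foldl_cat cats1 wx addnA.
  exact: subsets_step_bound.
rewrite -[X in tsize X]lstK tsize_unl; have := wsize_le acc_m.
have := wsize_take j (lst (l t)); rewrite -/s wsize_lst.
have := tsize_gt0 (l t); have := spine_lt (pad t); move: acc_le; rewrite /spine.
move: (size _) (size _) (wsize _) (wsize _) (tsize _) (tsize _) => *; nia.
Qed.

Lemma PTb_ok_itemT g ps f z : PT g -> PT ps -> PT f -> PT z ->
  PTb (fun t => ok_itemT (g t) (ps t) (f t) (z t)).
Proof.
by move=> *; rewrite /ok_itemT; do !(pt || apply: PT_srcT || apply: PT_snkT || apply: PTb_childT).
Qed.

Lemma PTb_okT g ps r f : PT g -> PT ps -> PT r -> PT f ->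
  PTb (fun t => okT (g t) (ps t) (r t) (f t)).
Proof.
by move=> *; rewrite /okT;
  do !(pt || apply: PT_deltaT || apply: PT_verts || apply: PT_srcT ||
       apply: PTb_memI || apply: PTb_ok_itemT).
Qed.

Lemma PT_nodesT pad g ps : PT pad -> PT g -> PT ps ->
  PT (fun t => nodesT (pad t) (g t) (ps t)).
Proof.
by move=> *; rewrite /nodesT;
  do !(pt || apply: PT_verts || apply: PTb_okT || apply: PT_subsetsT || apply: PT_windowT).
Qed.

Lemma PTb_transT g ps y x : PT g -> PT ps -> PT y -> PT x ->
  PTb (fun t => transT (g t) (ps t) (y t) (x t)).
Proof. by move=> *; rewrite /transT; do !(pt || apply: PTb_nearT || apply: PTb_memI). Qed.

Lemma PT_walkT pad g ps : PT pad -> PT g -> PT ps ->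
  PT (fun t => walkT (pad t) (g t) (ps t)).
Proof.
move=> Ppad Pg Pps; have PN := PT_nodesT Ppad Pg Pps.
apply: (PT_iter (F := fun t => walk_step (pad t) (g t) (ps t))
  (B := fun t => tsize (nodesT (pad t) (g t) (ps t)))) => //.
- by rewrite /walk_step; do !(pt || apply: PTb_transT || apply: PT_nodesT).
- exact: PT_size.
move=> t [|j] _; first exact: leqnn.
by rewrite iterS {1}/walk_step tsize_filter.
Qed.

Lemma PT_coverT : PT coverT.
Proof.
by rewrite /coverT; do !(pt || apply: PT_walkT || apply: PT_deltaT || apply: PT_verts).
Qed.

(** * Local conditions for shortest paths *)

Section Windows.

Variables (G : graph) (k : nat).
Local Notation V := (vertex G).
Variables (s t : 'I_k -> V).
Local Notation delta := (source_dist s).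
Local Notation item := ('I_(order G) * 'I_k)%type.
Implicit Types (F : seq item) (z y : item).

Definition near (r : nat) (v : V) : bool := (delta v <= r.+1) && (r <= (delta v).+1).

Definition child (i : 'I_k) (u v : V) : bool :=
  adj u v && (dist (pred1 (s i)) v == (dist (pred1 (s i)) u).+1).

Definition ok_item F z : bool :=
  ((z.1 == s z.2) || has (fun y => (y.2 == z.2) && child z.2 y.1 z.1) F) &&
  (count (fun y => (y.2 == z.2) && child z.2 z.1 y.1) F == ~~ (z.1 == t z.2)).

Definition ok_at (r : nat) F : bool :=
  [&& [forall v : V, (delta v == r) ==> has (fun z => z.1 == v) F],
      [forall i, (delta (s i) == r) ==> ((s i, i) \in F)] &
      all (fun z => (delta z.1 == r) ==> ok_item F z) F].

Definition consistent (r r' : nat) F F' : bool :=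
  all (fun z => near r z.1 ==> (z \in F)) F' && all (fun z => near r' z.1 ==> (z \in F')) F.

Definition coverable : Prop := exists P : 'I_k -> seq V,
  (forall i, shortest_path (s i) (t i) (P i)) /\ (forall x, exists i, x \in P i).

Lemma count1_eq (T : eqType) (p : pred T) (l : seq T) (a b : T) :
  count p l = 1 -> a \in l -> b \in l -> p a -> p b -> a = b.
Proof.
rewrite -size_filter => size1 al bl pa pb.
have: a \in filter p l by rewrite mem_filter pa.
have: b \in filter p l by rewrite mem_filter pb.
by case: (filter p l) size1 => [|c [|]] // _; rewrite !inE => /eqP -> /eqP ->.
Qed.

Lemma dist_adj A (u v : V) : adj u v -> dist A v <= (dist A u).+1.
Proof. by move=> uv; rewrite -addn1; apply/dist_close/close_adj. Qed.

Lemma near_adj (u v : V) : adj u v -> near (delta u) v.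
Proof.
by move=> uv; rewrite /near /source_dist !dist_adj // adj_sym.
Qed.

Section Soundness.

Variable F : nat -> seq item.
Hypothesis F_ok : forall r, r <= order G -> ok_at r (F r).
Hypothesis F_cons : forall r, r < order G -> consistent r r.+1 (F r) (F r.+1).
Hypothesis delta_lt : forall v : V, delta v < order G.

(** The global relation glued from the windows: whether [v] is on path [i] is read off the window
    centred at the layer of [v]. *)
Let Z (v : V) (i : 'I_k) : bool := (v, i) \in F (delta v).

(** Any other window that contains [v] is centred one layer away, and consistency of consecutive
    windows makes the two agree on [v]. *)
Lemma near_Z r v i : r <= order G -> near r v -> ((v, i) \in F r) = Z v i.
Proof.
move=> le_r; have near_self : near (delta v) v by rewrite /near !leqnSn.
have step j : j < order G -> near j v -> near j.+1 v ->
    ((v, i) \in F j) = ((v, i) \in F j.+1).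
  move=> /F_cons /andP[/allP sub1 /allP sub2] nj nj1.
  apply/idP/idP => [/sub2|/sub1] /=; first by rewrite nj1.
  by rewrite nj.
move=> near_r; have/andP[le1 le2] := near_r; rewrite /Z.
have [lt|gt|<-//] := ltngtP r (delta v).
  have e : delta v = r.+1 by lia.
  by rewrite e; apply: step; rewrite -?e // ltnW.
have e : r = (delta v).+1 by lia.
by rewrite e; apply/esym/step; rewrite -?e // ltnW.
Qed.

Lemma ok_Z v i : Z v i -> ok_item (F (delta v)) (v, i).
Proof.
have /F_ok/and3P[_ _ /allP ok] := ltnW (delta_lt v).
by move=> /ok; rewrite eqxx.
Qed.

Lemma Z_source i : Z (s i) i.
Proof.
by have /F_ok/and3P[_ /forallP/(_ i)] := ltnW (delta_lt (s i)); rewrite eqxx.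
Qed.

Lemma Z_cover v : exists i, Z v i.
Proof.
have /F_ok/and3P[/forallP/(_ v)] := ltnW (delta_lt v); rewrite eqxx /=.
by case/hasP=> -[u i] uF /= /eqP uv _ _; exists i; rewrite /Z -{1}uv.
Qed.

Lemma Z_adj u v i : adj u v -> ((v, i) \in F (delta u)) = Z v i.
Proof. by move=> uv; apply: near_Z (near_adj uv); apply/ltnW. Qed.

Lemma Z_parent v i : Z v i -> v != s i -> exists2 u, Z u i & child i u v.
Proof.
move=> /ok_Z/andP[/= + _] => /orP[-> //|/hasP[[u j] uF /= /andP[/eqP ji uv]] _].
exists u => //; rewrite ji in uF; rewrite -(Z_adj (u := v)) //.
by rewrite adj_sym; case/andP: uv.
Qed.

Lemma Z_child v i : Z v i -> v != t i -> exists2 u, Z u i & child i v u.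
Proof.
move=> /ok_Z/andP[/= _] + v_t; rewrite v_t => /eqP c1.
have: has (fun y : item => (y.2 == i) && child i v y.1) (F (delta v)) by rewrite has_count c1.
case/hasP=> -[u j] uF /= /andP[/eqP ji vu]; exists u => //.
by rewrite ji in uF; rewrite -(Z_adj (u := v)) //; case/andP: vu.
Qed.

Lemma Z_child_uniq v i u u' : Z v i -> Z u i -> Z u' i -> child i v u -> child i v u' -> u = u'.
Proof.
move=> /ok_Z/andP[/= _ /eqP c1] Zu Zu' vu vu'.
have uF : (u, i) \in F (delta v) by rewrite Z_adj //; case/andP: vu.
have u'F : (u', i) \in F (delta v) by rewrite Z_adj //; case/andP: vu'.
suff [] : (u, i) = (u', i) by [].
have has_child : has (fun y : item => (y.2 == i) && child i v y.1) (F (delta v)).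
  by apply/hasP; exists (u, i); rewrite //= eqxx.
apply: (count1_eq (p := fun y : item => (y.2 == i) && child i v y.1) _ uF u'F) => /=;
  rewrite ?eqxx //.
by rewrite has_count c1 in has_child; rewrite c1; case: eqP has_child.
Qed.

Lemma Z_target i u : Z (t i) i -> Z u i -> child i (t i) u = false.
Proof.
move=> /ok_Z/andP[/= _]; rewrite eqxx => /eqP c0 Zu; apply/negP => tu.
have: has (fun y : item => (y.2 == i) && child i (t i) y.1) (F (delta (t i))).
  apply/hasP; exists (u, i); rewrite //= ?eqxx //.
  by rewrite Z_adj //; case/andP: tu.
by rewrite has_count c0.
Qed.

Lemma dist_self (v : V) : dist (pred1 v) v = 0.
Proof.
have n_gt0 : 0 < order G by apply: leq_ltn_trans (ltn_ord v).
by apply/eqP; rewrite -leqn0 -dist_leq // /= inE.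
Qed.

(** Children are followed from [s i]. The distance to [s i] grows by one at each step, so the chain
    meets [t i] before exceeding the cap [order G], and it is shortest because its length is the
    distance of [t i]. By induction on the distance to [s i], every vertex of the set lies on it:
    its parent does, is not [t i], which has no child, and has no child but the next vertex of the
    chain. *)
Lemma Z_path i : exists p, shortest_path (s i) (t i) p /\ (forall v, Z v i -> v \in p).
Proof.
pose next v := odflt v [pick u | Z u i && child i v u].
have nextP v : Z v i -> v != t i -> Z (next v) i /\ child i v (next v).
  move=> Zv v_t; rewrite /next; case: pickP => [u /andP[]//|no].
  by have [u Zu vu] := Z_child Zv v_t; have := no u; rewrite Zu vu.
pose c j := iter j next (s i).
pose d := dist (pred1 (s i)).
have chain J : (forall j, j < J -> c j != t i) -> forall j, j <= J -> Z (c j) i /\ d (c j) = j.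
  move=> c_t; elim=> [|j IH] le_j; first by rewrite /d /= dist_self Z_source.
  have [Zc dc] := IH (ltnW le_j); have [Zn /andP[_ /eqP dn]] := nextP _ Zc (c_t j le_j).
  by split=> //; rewrite /d /= dn -/(d (c j)) dc.
have hit : exists j, c j == t i.
  have [/existsP[j cj]|/existsPn no] := boolP [exists j : 'I_(order G).+2, c j == t i].
    by exists j.
  have := chain (order G).+1 _ (order G).+1 (leqnn _).
  case=> [j lt_j|_ dc]; first exact: (no (Ordinal (ltnW lt_j : j < (order G).+2))).
  by have := dist_le_order (pred1 (s i)) (c (order G).+1); rewrite -/(d _) dc ltnn.
case: (ex_minnP hit) => J /eqP cJ J_min.
have c_t j : j < J -> c j != t i by apply: contraTneq => /eqP/J_min; rewrite -leqNgt.
have {}chain := chain J c_t.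
have d_t : d (t i) = J by rewrite -cJ; case: (chain J).
exists [seq c j | j <- iota 0 J.+1]; split.
  split.
    rewrite /= eqxx /=; apply/and3P; split.
    - apply/(pathP (s i)) => j; rewrite size_map size_iota => lt_j.
      have [Zc _] := chain j (ltnW lt_j); have [_ /andP[+ _]] := nextP _ Zc (c_t j lt_j).
      rewrite (nth_map 0) ?size_iota // nth_iota // add1n.
      case: j lt_j Zc => [|j] lt_j Zc //=.
      by rewrite (nth_map 0) ?size_iota 1?ltnW // nth_iota 1?ltnW // add1n.
    - rewrite (last_map c _ 0) (last_nth 0) size_iota -cJ.
      by rewrite -[0 :: _]/(iota 0 J.+1) nth_iota.
    - rewrite -[_ && _]/(uniq [seq c j | j <- iota 0 J.+1]).
      rewrite map_inj_in_uniq ?iota_uniq // => a b; rewrite !mem_iota !add0n !ltnS /= => aJ bJ ab.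
      by have [_ <-] := chain a aJ; have [_ <-] := chain b bJ; rewrite ab.
  move=> [//|x q] /= /and4P[/eqP -> sq /eqP q_t _]; rewrite size_map size_iota ltnS -d_t.
  by have := dist_close (pred1 (s i)) (path_close sq); rewrite dist_self q_t.
move=> v; move: {-1}(d v) (erefl (d v)) => m; elim: m v => [|m IH] v dv Zv.
  have [->|v_s] := eqVneq v (s i); first by rewrite /= inE eqxx.
  by have [u _ /andP[_]] := Z_parent Zv v_s; rewrite -/(d v) dv.
have v_s : v != s i by apply/eqP => v_s; move: dv; rewrite v_s /d dist_self.
have [u Zu uv] := Z_parent Zv v_s.
have du : d u = m by case/andP: (uv) => _ /eqP; rewrite -/(d v) dv -/(d u) => -[].
have /mapP[j j_in uj] := IH u du Zu.
have le_j : j <= J by move: j_in; rewrite mem_iota.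
have [ej|ne_j] := eqVneq j J.
  by move: uv Zu; rewrite uj ej cJ => uv Zu; rewrite Z_target in uv.
have lt_j : j < J by rewrite ltn_neqAle ne_j.
have [Zc _] := chain j le_j; have [Zn cn] := nextP _ Zc (c_t j lt_j).
rewrite uj in uv; rewrite (Z_child_uniq Zc Zv Zn uv cn).
by apply/mapP; exists j.+1; rewrite // mem_iota.
Qed.

Lemma windows_sound : coverable.
Proof.
have [P Pp] := fin_all_exists Z_path.
exists P; split=> [i|x]; first by case: (Pp i).
by have [i /(Pp i).2] := Z_cover x; exists i.
Qed.

End Soundness.

Section Completeness.

Variable P : 'I_k -> seq V.
Hypothesis P_shortest : forall i, shortest_path (s i) (t i) (P i).
Hypothesis P_cover : forall x, exists i, x \in P i.

(** On a shortest path the distance to [s i] is the index, so the only child of a vertex within the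
    path is its successor there. [uniq F] lets [count] count vertices. *)
Lemma windows_complete r F : uniq F ->
  (forall v i, near r v -> ((v, i) \in F) = (v \in P i)) -> ok_at r F.
Proof.
move=> F_uniq FP.
have near_self v : delta v = r -> near r v by rewrite /near => ->; rewrite !leqnSn.
have near_of v u : delta v = r -> adj v u -> near r u by move=> <-; apply: near_adj.
apply/and3P; split.
- apply/forallP=> v; apply/implyP=> /eqP/near_self v_r; have [i vi] := P_cover v.
  by apply/hasP; exists (v, i); rewrite //= FP.
- apply/forallP=> i; apply/implyP=> /eqP/near_self v_r.
  by rewrite FP //; apply: shortest_head (P_shortest i).
apply/allP=> -[v i] vF; apply/implyP=> /= /eqP v_r.
have vi : v \in P i by rewrite -FP // near_self.
have dE u : u \in P i -> dist (pred1 (s i)) u = index u (P i).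
  exact: shortest_dist (P_shortest i) u.
have P_uniq := shortest_uniq (P_shortest i).
pose j := index v (P i); have v_j : nth (s i) (P i) j = v by rewrite nth_index.
have lt_j : j < size (P i) by rewrite index_mem.
have in_F u : adj v u -> ((u, i) \in F) = (u \in P i) by move=> vu; apply/FP/(near_of v).
have child_in u : child i v u -> u \in P i ->
    j.+1 < size (P i) /\ u = nth (s i) (P i) j.+1.
  move=> /andP[_ uj] ui; rewrite !dE // -/j in uj; move/eqP: uj => uj.
  by split; [rewrite -uj index_mem | rewrite -uj nth_index].
have nth_child m : m.+1 < size (P i) -> child i (nth (s i) (P i) m) (nth (s i) (P i) m.+1).
  move=> lt_m; rewrite /child (shortest_adj (P_shortest i) lt_m) /=.
  by rewrite !dE ?mem_nth ?index_uniq // ltnW.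
apply/andP; split=> /=.
  have [//|v_s] := eqVneq v (s i); case ej: (j) => [|m].
    move: v_j; rewrite ej => v_m; by rewrite -v_m (shortest_first (P_shortest i)) eqxx in v_s.
  have lt_m : m.+1 < size (P i) by rewrite -ej.
  have c_m := nth_child m lt_m; rewrite -ej v_j in c_m.
  apply/hasP; exists (nth (s i) (P i) m, i); rewrite /= ?eqxx //.
  rewrite in_F ?mem_nth 1?ltnW // adj_sym.
  by case/andP: c_m.
case: (ltnP j.+1 (size (P i))) => [lt_j1|ge_j1].
  have c_j := nth_child j lt_j1; rewrite v_j in c_j.
  have -> : v == t i = false.
    apply/eqP => v_t; have := shortest_last (P_shortest i); rewrite -v_t -v_j => /eqP.
    by rewrite nth_uniq //; move: lt_j1; case: (size _) => //= m; lia.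
  (* The count is 1 once the predicate is seen to single out, within [F], the item of the next
     vertex of the path. *)
  rewrite (_ : nat_of_bool _ = 1) // -(_ : count_mem (nth (s i) (P i) j.+1, i) F = 1); last first.
    rewrite count_uniq_mem // in_F ?mem_nth //.
    by case/andP: c_j.
  apply/eqP/eq_in_count => -[u i'] uF /=; rewrite xpair_eqE andbC.
  case: eqP => [i'i|_]; rewrite ?andbF //= !andbT.
  apply/idP/eqP => [vu|-> //]; rewrite i'i in uF.
  by apply: (proj2 (child_in u vu _)); rewrite -in_F //; case/andP: vu.
have -> : v == t i.
  rewrite -(shortest_last (P_shortest i)) -[X in X == _]v_j; apply/eqP; congr nth.
  by move: ge_j1 lt_j; case: (size _) => //= m; lia.
rewrite -leqn0 leqNgt -has_count; apply/hasP => -[[u i'] uF /= /andP[/eqP i'i vu]].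
have [|lt_j1 _] := child_in u vu; last by rewrite ltnNge ge_j1 in lt_j1.
by rewrite i'i in uF; rewrite -in_F //; case/andP: vu.
Qed.

End Completeness.
End Windows.

(** * Correctness *)

Fixpoint eq_tree (a b : tree) : bool :=
  match a, b with
  | Leaf, Leaf => true
  | Node a1 a2, Node b1 b2 => eq_tree a1 b1 && eq_tree a2 b2
  | _, _ => false
  end.

Lemma eq_treeP : Equality.axiom eq_tree.
Proof.
move=> a b; apply: (iffP idP) => [|<-]; last by elim: a => //= a1 -> a2 ->.
by elim: a b => [|a1 IH1 a2 IH2] [|b1 b2] //= /andP[/IH1 -> /IH2 ->].
Qed.

HB.instance Definition _ := hasDecEq.Build tree eq_treeP.

Lemma enc_seqE (A : Type) (a : A -> tree) l : enc_seq a l = unl (map a l).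
Proof. by elim: l => //= x l ->. Qed.

Section Subsets.

Variable pad : tree.

Lemma subsets_sub l f : f \in lst (subsetsT pad l) -> {subset lst f <= lst l}.
Proof.
rewrite /subsetsT; elim/last_ind: (lst l) f => [|s x IH] f /=.
  by rewrite inE => /eqP ->.
rewrite -cats1 foldl_cat /= /subsets_step; set acc := foldl _ _ _ in IH *.
have sub_s h : h \in lst acc -> {subset lst h <= s ++ [:: x]}.
  by move=> /IH sub z /sub; rewrite mem_cat => ->.
case: ifP => _; last exact: sub_s.
rewrite /tcat unlK mem_cat /tmap unlK => /orP[/sub_s //|/mapP[h /sub_s sub ->]].
by move=> z /=; rewrite inE => /orP[/eqP ->|/sub //]; rewrite mem_cat inE eqxx orbT.
Qed.

(** With so large a padding the guard always passes and the list of subsets doubles at each element.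
    Elements are prepended while [l] is read from the left, whence [rev]. *)
Lemma subsets_all l p : 2 ^ spine l <= spine pad ->
  unl (rev (filter p (lst l))) \in lst (subsetsT pad l).
Proof.
rewrite /subsetsT /spine -/(spine pad) => pad_big.
(* The exact length is carried through the induction in order to evaluate the guard. *)
suff [] : size (lst (foldl (subsets_step pad) (Node Leaf Leaf) (lst l))) = 2 ^ size (lst l) /\
  unl (rev (filter p (lst l))) \in lst (foldl (subsets_step pad) (Node Leaf Leaf) (lst l)) by [].
elim/last_ind: (lst l) pad_big => [|s x IH]; first by rewrite /= inE.
rewrite size_rcons expnS => pad_big; have [|size_acc acc_p] := IH; first lia.
rewrite -cats1 foldl_cat /= /subsets_step; set acc := foldl _ _ _ in size_acc acc_p *.
have size_new : spine (tcat acc (tmap (fun f => Node x f) acc)) = 2 * 2 ^ size s.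
  by rewrite /tcat spine_unl size_cat /tmap unlK size_map size_acc mul2n addnn.
rewrite size_new pad_big; split; first exact: size_new.
rewrite /tcat unlK mem_cat filter_cat /= rev_cat; case: (p x) => /=; last by rewrite acc_p.
apply/orP; right; rewrite /tmap unlK; apply/mapP.
by exists (unl (rev (filter p s))).
Qed.

End Subsets.

Section Walk.

Variables (pad g ps : tree).
Let N := lst (nodesT pad g ps).

Lemma walk_step_mem R x : (x \in lst (walk_step pad g ps R)) =
  (x \in N) && has (fun y => transT g ps y x) (lst R).
Proof. by rewrite lst_filter mem_filter andbC. Qed.

Lemma walk_sound j x : x \in lst (iter j (walk_step pad g ps) (nodesT pad g ps)) ->
  exists w : nat -> tree, [/\ w j = x, forall i, i <= j -> w i \in N &
    forall i, i < j -> transT g ps (w i) (w i.+1)].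
Proof.
elim: j x => [|j IH] x; first by exists (fun=> x); split=> // i.
rewrite iterS walk_step_mem => /andP[xN /hasP[y /IH[w [wj wN w_trans]] yx]].
exists (fun i => if i == j.+1 then x else w i); rewrite eqxx; split=> // i.
  by rewrite leq_eqVlt ltnS; case: eqP => // _ /wN.
rewrite ltnS eqSS => le_i; rewrite ltn_eqF //; case: eqVneq => [->|ne_i].
  by rewrite wj.
by apply: w_trans; rewrite ltn_neqAle ne_i.
Qed.

Lemma walk_complete (w : nat -> tree) m :
  (forall i, i <= m -> w i \in N) -> (forall i, i < m -> transT g ps (w i) (w i.+1)) ->
  w m \in lst (iter m (walk_step pad g ps) (nodesT pad g ps)).
Proof.
move=> wN w_trans; elim: m wN w_trans => [|m IH] wN w_trans; first exact: wN.
rewrite iterS walk_step_mem wN //=; apply/hasP; exists (w m); last exact: w_trans.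
by apply: IH => i le_i; [apply/wN/leqW | apply/w_trans/leqW].
Qed.

End Walk.

Lemma all_map_enum (T : finType) (A : Type) (h : T -> A) (p : pred A) :
  all p (map h (enum T)) = [forall a, p (h a)].
Proof.
transitivity (all (preim h p) (enum T)); first by elim: (enum T) => //= x l ->.
by apply/allP/forallP => ph x; [apply: ph; rewrite mem_enum | move=> _; apply: ph].
Qed.

(** * Agreement of the tests on trees with those on the graph *)

Section Encoding.

Variables (G : graph) (k : nat) (pairs : k.-tuple (vertex G * vertex G)).
Local Notation V := (vertex G).
Local Notation n := (order G).
Local Notation delta := source_dist.
Local Notation item := ('I_n * 'I_k)%type.

Let s i := (tnth pairs i).1.
Let t i := (tnth pairs i).2.
Let g := enc_graph G.
Let ps := enc_seq (enc_pair (@enc_vertex G) (@enc_vertex G)) pairs.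
Let ev (v : 'I_n) := enc_nat v.
Let ei (i : 'I_k) := enc_nat i.
Let it (z : item) := Node (ev z.1) (ei z.2).

Lemma spine_g : spine g = n.
Proof. by rewrite /g /enc_graph enc_seqE spine_unl size_map size_enum_ord. Qed.

Lemma spine_ps : spine ps = k.
Proof. by rewrite /ps enc_seqE spine_unl size_map size_tuple. Qed.

Lemma lst_verts u m : spine u = m -> lst (verts u) = [seq enc_nat i | i : 'I_m].
Proof. by move=> <-; rewrite unlK -val_enum_ord -map_comp. Qed.

Lemma verts_g : lst (verts g) = map ev (enum 'I_n).
Proof. exact: lst_verts spine_g. Qed.

Lemma verts_ps : lst (verts ps) = map ei (enum 'I_k).
Proof. exact: lst_verts spine_ps. Qed.

Lemma adjT_enc u v : adjT g (ev u) (ev v) = adj u v.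
Proof.
rewrite /adjT /tree_nth !spine_enc_nat /g /enc_graph enc_seqE unlK.
rewrite (nth_map u) ?size_enum_ord // nth_ord_enum enc_seqE unlK.
by rewrite (nth_map v) ?size_enum_ord // nth_ord_enum isn_enc_bool.
Qed.

Lemma eq_ev u v : (spine (ev u) == spine (ev v)) = (u == v).
Proof. by rewrite !spine_enc_nat. Qed.

Lemma eq_ei i j : (spine (ei i) == spine (ei j)) = (i == j).
Proof. by rewrite !spine_enc_nat. Qed.

Lemma ballT_enc (b : seq V) r : exists l : seq V,
  lst (ballT g (unl (map ev b)) r) = map ev l /\
  forall v, (v \in l) = within (mem b) (spine r) v.
Proof.
rewrite /ballT; elim: (spine r) => [|j [l [ballE lE]]]; first by exists b; rewrite unlK.
rewrite iterS /nextT ballE; set B := iter _ _ _ in ballE *.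
exists [seq v <- enum 'I_n | has (fun u => (u == v) || adj u v) l]; split.
  rewrite unlK verts_g filter_map; congr map; apply: eq_filter => v /=.
  by rewrite has_map; apply: eq_has => u /=; rewrite eq_ev adjT_enc.
move=> v; rewrite mem_filter mem_enum andbT within_succ.
apply/hasP/existsP => [[u ul uv]|[u /andP[ul uv]]]; exists u => //.
  by rewrite -lE ul.
by rewrite lE.
Qed.

Lemma memT_enc v u (l : seq V) : lst u = map ev l -> memT (ev v) u = (v \in l).
Proof.
by rewrite /memT => ->; rewrite has_map -has_pred1; apply: eq_has => w /=; rewrite eq_ev.
Qed.

Lemma distT_enc (b : seq V) v : spine (distT g (unl (map ev b)) (ev v)) = dist (mem b) v.
Proof.
rewrite /distT spine_unl size_filter unlK spine_g count_map /dist.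
apply: eq_count => r /=; have [l [ballE lE]] := ballT_enc b (enc_nat r).
by rewrite (memT_enc _ ballE) lE spine_enc_nat.
Qed.

Lemma within_eq (A B : {pred V}) : A =i B -> forall r, within A r =1 within B r.
Proof.
move=> AB; elim=> [|r IH] v; first exact: AB.
by rewrite !within_succ; apply: eq_existsb => u; rewrite IH.
Qed.

Lemma dist_eq (A B : {pred V}) : A =i B -> dist A =1 dist B.
Proof. by move=> AB v; apply: eq_count => r; rewrite (within_eq AB). Qed.

Lemma pair_enc i : tree_nth ps (spine (ei i)) = Node (ev (s i)) (ev (t i)).
Proof.
rewrite /tree_nth spine_enc_nat /ps enc_seqE unlK (nth_map (tnth pairs i)) ?size_tuple //.
by rewrite -tnth_nth.
Qed.

Lemma srcT_enc i : srcT ps (ei i) = ev (s i).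
Proof. by rewrite /srcT pair_enc. Qed.

Lemma snkT_enc i : snkT ps (ei i) = ev (t i).
Proof. by rewrite /snkT pair_enc. Qed.

Lemma deltaT_enc v : spine (deltaT g ps (ev v)) = delta s v.
Proof.
have -> : deltaT g ps (ev v) = distT g (unl (map ev (sources s))) (ev v).
  congr distT; rewrite /tmap /ps enc_seqE unlK -map_comp; congr unl.
  by rewrite -[in LHS](map_tnth_enum pairs) -!map_comp; apply: eq_map => i.
exact: distT_enc.
Qed.

Lemma childT_enc i u v : childT g (Node (ev (s i)) Leaf) (ev u) (ev v) = child s i u v.
Proof.
have dE w : spine (distT g (Node (ev (s i)) Leaf) (ev w)) = dist (pred1 (s i)) w.
  rewrite (distT_enc [:: s i]); apply: dist_eq => x.
  by rewrite inE.
by rewrite /childT adjT_enc /child /spine /= -!/(spine _) !dE.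
Qed.

Lemma nearT_enc r v : nearT g ps r (ev v) = near s (spine r) v.
Proof. by rewrite /nearT /spine /= -!/(spine _) deltaT_enc. Qed.

Local Opaque nearT.

Lemma eq_it z y : (spine (thd (it y)) == spine (thd (it z))) &&
  (spine (ttl (it y)) == spine (ttl (it z))) = (y == z).
Proof. by rewrite /= eq_ev eq_ei -pair_eqE. Qed.

Lemma memI_enc z (F : seq item) : memI (it z) (unl (map it F)) = (z \in F).
Proof.
by rewrite /memI unlK has_map -has_pred1; apply: eq_has => y; rewrite /= -eq_it.
Qed.

Lemma ok_itemT_enc (F : seq item) z : ok_itemT g ps (unl (map it F)) (it z) = ok_item s t F z.
Proof.
rewrite /ok_itemT /ok_item /= srcT_enc snkT_enc !eq_ev /tfilter spine_unl size_filter.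
rewrite unlK has_map count_map; congr (_ && _).
  by congr (_ || _); apply: eq_has => y /=; rewrite eq_ei childT_enc.
congr (_ == _); last by case: (_ == _).
by apply: eq_count => y /=; rewrite eq_ei childT_enc.
Qed.

Lemma okT_enc r (F : seq item) : okT g ps r (unl (map it F)) = ok_at s t (spine r) F.
Proof.
rewrite /okT /ok_at verts_g verts_ps unlK !all_map_enum; congr [&& _, _ & _].
- apply: eq_forallb => v; rewrite deltaT_enc has_map.
  by under eq_has do rewrite /= eq_ev.
- apply: eq_forallb => i.
  by rewrite srcT_enc deltaT_enc -/(it (s i, i)) memI_enc.
by rewrite all_map; apply: eq_all => z /=; rewrite deltaT_enc ok_itemT_enc.
Qed.

Lemma transT_enc r r' (F F' : seq item) :
  transT g ps (Node r (unl (map it F))) (Node r' (unl (map it F'))) =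
  (spine r' == (spine r).+1) && consistent s (spine r) (spine r') F F'.
Proof.
rewrite /transT /consistent /= !unlK !all_map; congr [&& _, _ & _].
  by apply: eq_all => z /=; rewrite nearT_enc memI_enc.
by apply: eq_all => z /=; rewrite nearT_enc memI_enc.
Qed.

Definition window r : seq item :=
  [seq (v, i) | v <- [seq v <- enum 'I_n | near s r v], i <- enum 'I_k].

Lemma windowT_enc r : lst (windowT g ps r) = map it (window (spine r)).
Proof.
rewrite /windowT lst_flat verts_g /window; elim: (enum 'I_n) => [//|v l IH].
rewrite /= IH nearT_enc; case: ifP => [_|_]; last exact: erefl.
rewrite /= map_cat; congr (_ ++ _).
by rewrite lst_map verts_ps -!map_comp.
Qed.

Lemma mem_window r v i : ((v, i) \in window r) = near s r v.
Proof.
apply/allpairsP/idP => [[[u j] /= [+ _ [-> _]]]|near_v].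
  by rewrite mem_filter => /andP[].
by exists (v, i); rewrite /= mem_filter near_v !mem_enum.
Qed.

Lemma it_list (f : tree) (F : seq item) : {subset lst f <= map it F} ->
  exists F', f = unl (map it F').
Proof.
rewrite -{2}(lstK f); elim: (lst f) => [|x l IH] sub; first by exists [::].
have [|F' e] := IH; first by move=> y yl; apply: sub; rewrite inE yl orbT.
by have /mapP[z _ ->] := sub x (mem_head _ _); exists (z :: F'); rewrite /= -e.
Qed.

Local Opaque okT windowT subsetsT.

Lemma nodesT_mem pad x : reflect (exists (r : 'I_n.+1) f,
    [/\ x = Node (enc_nat r) f, f \in lst (subsetsT pad (windowT g ps (enc_nat r))) &
      okT g ps (enc_nat r) f]) (x \in lst (nodesT pad g ps)).
Proof.
have verts_n : lst (verts (Node Leaf g)) = [seq enc_nat r | r : 'I_n.+1].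
  by apply: lst_verts; rewrite /spine /= -/(spine g) spine_g.
rewrite /nodesT lst_flat verts_n -map_comp; apply: (iffP flattenP).
  move=> [l /mapP[r _ ->]]; rewrite /= lst_filter mem_filter lst_map => /andP[ok /mapP[f f_in x_f]].
  by exists r, f; split=> //; move: ok; rewrite x_f.
move=> [r [f [-> f_in ok]]]; eexists; first by apply: map_f; rewrite mem_enum.
by rewrite /= lst_filter mem_filter /= ok lst_map; apply: map_f.
Qed.

Let input pad := Node pad (Node g ps).

Lemma coverT_enc pad : coverT (input pad) = enc_bool
  (isn (walkT pad g ps) && [forall v : V, delta s v < n]).
Proof.
rewrite /coverT /= verts_g all_map_enum; congr (enc_bool (_ && _)).
by apply: eq_forallb => v; rewrite /spine /= -!/(spine _) deltaT_enc spine_g.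
Qed.

(** This holds for any padding, since a truncated list of subsets only removes candidates. *)
Lemma coverT_sound pad : coverT (input pad) <> Leaf -> coverable s t.
Proof.
rewrite coverT_enc; case: andP => [[walk /forallP delta_lt] _|_ /(_ erefl) //].
have [x xR] : exists x, x \in lst (walkT pad g ps).
  by case: (walkT pad g ps) walk => // x y _; exists x; apply: mem_head.
have [w [_ wN w_trans]] := walk_sound xR; rewrite spine_g in wN w_trans.
pose rank i := spine (thd (w i)).
have rankS i : i < n -> rank i.+1 = (rank i).+1.
  by move=> /w_trans/and3P[/eqP].
have rank_le i : i <= n -> rank i <= n.
  move=> /wN/nodesT_mem[r [f [wi _ _]]].
  by rewrite /rank wi spine_enc_nat -ltnS.
have rank_add i : i <= n -> rank i = rank 0 + i.
  by elim: i => [|i IH] le_i; rewrite ?addn0 // rankS // IH 1?ltnW // addnS.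
have rankE i : i <= n -> rank i = i.
  move=> /rank_add ->; suff -> : rank 0 = 0 by [].
  by have := rank_le n (leqnn n); rewrite rank_add //; lia.
have wF (r : 'I_n.+1) : exists F : seq item,
    w r = Node (enc_nat r) (unl (map it F)) /\ ok_at s t r F.
  have /nodesT_mem[r' [f [wr f_in ok]]] := wN r (ltn_ord r).
  have [|F f_F] := @it_list f (window r').
    by move=> z /(subsets_sub f_in); rewrite windowT_enc spine_enc_nat.
  have r'r : r' = r :> nat by rewrite -(rankE r (ltn_ord r)) /rank wr spine_enc_nat.
  exists F; rewrite wr f_F r'r; split=> //.
  by move: ok; rewrite f_F okT_enc spine_enc_nat r'r.
have [F {}wF] := fin_all_exists wF; pose F' i := F (inord i).
have wF' i : i <= n -> w i = Node (enc_nat i) (unl (map it (F' i))) /\ ok_at s t i (F' i).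
  by move=> le_i; have := wF (inord i); rewrite !inordK.
apply: (windows_sound (F := F')) => // r le_r; first by case: (wF' r le_r).
have := w_trans r le_r; have [-> _] := wF' r (ltnW le_r); have [-> _] := wF' r.+1 le_r.
by rewrite transT_enc !spine_enc_nat => /andP[].
Qed.

(** Three layers, with [k] items for each vertex. At [r = 0] the truncated [r.-1] merely counts
    layer 0 twice. *)
Lemma window_size (P : 'I_k -> seq V) r :
  (forall i, shortest_path (s i) (t i) (P i)) -> (forall x, exists i, x \in P i) ->
  size (window r) <= k * (3 * (k * (k * 20) ^ k)).
Proof.
move=> P_shortest P_cover; rewrite size_allpairs size_enum_ord mulnC leq_mul //.
have -> : size [seq v <- enum 'I_n | near s r v] = #|[set v : V | near s r v]|.
  rewrite cardE /enum_mem -filter_predI /=; congr size.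
  by apply: eq_filter => v; rewrite !inE andbT.
have sub : [set v : V | near s r v] \subset [set v : V | delta s v == r.-1] :|:
    [set v : V | delta s v == r] :|: [set v : V | delta s v == r.+1].
  apply/subsetP=> v; rewrite !inE /near => /andP[le1 le2].
  by case: ltngtP le1 => // + _; case: ltngtP; rewrite ?orbT //; lia.
apply: leq_trans (subset_leq_card sub) _.
apply: leq_trans (leq_card_setU _ _) _.
apply: leq_trans (leq_add (leq_card_setU _ _) (leqnn _)) _.
have bound := layer_bound P_shortest P_cover.
rewrite !mulSn mul0n addn0 addnA; do !apply: leq_add; exact: bound.
Qed.

Lemma coverT_complete pad : 2 ^ (k * (3 * (k * (k * 20) ^ k))) <= spine pad ->
  coverable s t -> coverT (input pad) <> Leaf.
Proof.
move=> pad_big [P [P_shortest P_cover]].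
have delta_lt := delta_lt P_shortest P_cover.
pose Z (z : item) := z.1 \in P z.2.
(* Reversed so as to be literally an entry of the list of subsets, as given by [subsets_all]. *)
pose F r := rev (filter Z (window r)).
have F_uniq r : uniq (F r).
  rewrite rev_uniq; apply/filter_uniq/allpairs_uniq; last by move=> [a b] [a' b'] _ _ [-> ->].
    exact/filter_uniq/enum_uniq.
  exact: enum_uniq.
have FP r v i : near s r v -> ((v, i) \in F r) = (v \in P i).
  by move=> v_r; rewrite mem_rev mem_filter mem_window v_r andbT.
have F_near r z : z \in F r -> near s r z.1 && Z z.
  by case: z => v i; rewrite mem_rev mem_filter mem_window andbC.
pose w r := Node (enc_nat r) (unl (map it (F r))).
have wN r : r <= n -> w r \in lst (nodesT pad g ps).
  move=> le_r; apply/nodesT_mem; exists (Ordinal (le_r : r < n.+1)), (unl (map it (F r))).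
  split=> //; last by rewrite okT_enc spine_enc_nat; apply: windows_complete (FP r).
  have size_W : spine (windowT g ps (enc_nat r)) <= k * (3 * (k * (k * 20) ^ k)).
    by rewrite /spine windowT_enc size_map spine_enc_nat (window_size _ P_shortest).
  (* [subsets_all] filters trees, so the predicate [Z] is transported to the codes of items. *)
  have := @subsets_all pad (windowT g ps (enc_nat r))
    (fun x => has (fun z => Z z && (it z == x)) (window r)).
  have -> : unl (rev (filter (fun x => has (fun z => Z z && (it z == x)) (window r))
      (lst (windowT g ps (enc_nat r))))) = unl (map it (F r)).
    rewrite windowT_enc spine_enc_nat filter_map map_rev; congr (unl (rev (map _ _))).
    apply: eq_in_filter => z z_in /=; apply/hasP/idP => [[y _ /andP[Zy /eqP yz]]|Zz].
      suff <- : y = z by [].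
      by apply/eqP; rewrite -eq_it yz !eqxx.
    by exists z; rewrite // Zz eqxx.
  by apply; apply: leq_trans pad_big; rewrite leq_exp2l.
have w_trans r : r < n -> transT g ps (w r) (w r.+1).
  move=> lt_r; rewrite transT_enc !spine_enc_nat eqxx /=; apply/andP; split.
    by apply/allP=> -[v i] /F_near/andP[_ vi]; apply/implyP=> /= v_r; rewrite FP.
  by apply/allP=> -[v i] /F_near/andP[_ vi]; apply/implyP=> /= v_r; rewrite FP.
rewrite coverT_enc (_ : [forall v : V, delta s v < n]); last exact/forallP.
have := walk_complete wN w_trans; rewrite -[X in iter X]spine_g -/(walkT pad g ps).
by case: (walkT pad g ps).
Qed.

End Encoding.

(** * The two problems *)

(** A tower of exponentials is generous, but it needs no programs other than those for successor and
    powers of 2. *)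
Definition pad_size (k : nat) : nat := iter 5 (expn 2) (3 + k).

Lemma honest_pad_size : honest pad_size.
Proof. exact: honest_comp (honest_addn 3) (honest_iter 5 honest_exp2). Qed.

(** With [m = k * k + 20], the exponent on the left is at most [m ^ (2 * m + 3)], hence at most
    [2 ^ (m * (2 * m + 3))] and [2 ^ 2 ^ (2 * m + 2)], while [2 * m + 2 <= 2 ^ 2 ^ (3 + k)]. The
    square of [k] makes room for the pairs formed from [k] terminals. *)
Lemma pad_size_bound k k' : k' <= k * k -> 2 ^ (k' * (3 * (k' * (k' * 20) ^ k'))) <= pad_size k.
Proof.
have sq x : x ^ 2 = x * x by rewrite expnS expn1.
move=> le_k'; rewrite /pad_size !iterS leq_exp2l //; set m := k * k + 20.
have le_m : 2 * m + 2 <= 2 ^ 2 ^ (3 + k).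
  have k_lt := ltn_expl k (ltnSn 1).
  apply: (@leq_trans (2 ^ (2 * k + 6))).
    rewrite expnD (mulnC 2 k) expnM sq -[2 ^ 6]/(64) /m.
    move: (2 ^ k) k_lt => x; nia.
  rewrite leq_exp2l // expnD -[2 ^ 3]/(8).
  by move: (2 ^ k) k_lt => x; lia.
have [le_km m_ge] : k' <= m /\ 20 <= m by rewrite /m; lia.
clearbody m; have m_lt := ltn_expl m (ltnSn 1).
apply: (@leq_trans (2 ^ (m * (2 * m + 3)))).
  rewrite expnM; apply: leq_trans (leq_exp_base _ (ltnW m_lt)).
  rewrite (_ : 2 * m + 3 = 1 + (1 + (1 + m * 2))); last by lia.
  rewrite (expnD m 1) (expnD m 1) (expnD m 1) !expn1.
  have le_pow : (k' * 20) ^ k' <= m ^ (m * 2).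
    rewrite mulnC (mulnC m) expnM.
    apply: leq_trans (leq_exp_base k' (_ : 20 * k' <= m ^ 2)) _.
      by rewrite sq leq_mul.
    by apply: leq_exp_exponent; rewrite // expn_gt0; lia.
  have m3 : 3 <= m by lia.
  by do 3!(apply: leq_mul => //).
rewrite leq_exp2l //; apply: (@leq_trans (2 ^ (2 * m + 2))); last by rewrite leq_exp2l.
rewrite expnD (mulnC 2 m) expnM sq -[2 ^ 2]/(4).
by move: (2 ^ m) m_lt => x; nia.
Qed.

Lemma FPT_ipct : FPT isometric_path_cover_with_terminals.
Proof.
apply: (FPT_padded (kappa := fun t => tmap (fun=> Leaf) (ttl t)) honest_pad_size PT_coverT).
- by pt.
- by move=> [G k pairs] /=; rewrite enc_seqE tmap_leaf spine_unl size_map size_tuple.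
move=> [G k pairs] pad /= pad_big; split=> [/coverT_sound //|yes].
have le_k : k <= k * k by rewrite -{1}(muln1 k) leq_mul2l; case: (posnP k).
by apply: coverT_complete yes; apply: leq_trans (pad_size_bound le_k) pad_big.
Qed.

(** * From sets of terminals to pairs *)

Lemma is_path_rev (G : graph) (u v : vertex G) p : is_path u v p -> is_path v u (rev p).
Proof.
case: p => // x q /and4P[/eqP -> uq /eqP q_v uniq_q].
have e : rev (u :: q) = v :: rev (belast u q) by rewrite lastI q_v rev_rcons.
rewrite e; apply/and4P; split=> //; last by rewrite -e rev_uniq.
  by rewrite -q_v rev_path (eq_path (e' := @adj G)) // => a b; apply: adj_sym.
by rewrite -q_v; case: q {uq q_v uniq_q e} => //= y q; rewrite rev_cons last_rcons.
Qed.

Lemma shortest_path_rev (G : graph) (u v : vertex G) p :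
  shortest_path u v p -> shortest_path v u (rev p).
Proof.
case=> uv p_min; split=> [|q vu]; first exact: is_path_rev.
by rewrite size_rev -(size_rev q); apply/p_min/is_path_rev.
Qed.

Section Terminals.

Variables (G : graph) (S : {set 'I_(order G)}).

(** Requiring the ends to be increasing lists each 2-element set of terminals exactly once. *)
Definition terminal_pairs : seq (vertex G * vertex G) :=
  [seq p : 'I_(order G) * 'I_(order G) <- [seq (u, v) | u <- enum S, v <- enum S] | p.1 < p.2].

Let s i := (tnth (in_tuple terminal_pairs) i).1.
Let t i := (tnth (in_tuple terminal_pairs) i).2.

Lemma mem_terminal_pairs u v :
  ((u, v) \in terminal_pairs) = [&& u \in S, v \in S & u < v].
Proof.
rewrite mem_filter /= andbC; apply/andP/and3P => [[/allpairsP[[a b] [/=]]]|[uS vS lt]].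
  by rewrite !mem_enum => aS bS [-> ->].
by split=> //; apply/allpairsP; exists (u, v); rewrite /= !mem_enum.
Qed.

Lemma size_terminal_pairs : size terminal_pairs <= #|S| * #|S|.
Proof.
rewrite size_filter; apply: leq_trans (count_size _ _) _.
by rewrite size_allpairs -cardE.
Qed.

Lemma terminal_pair_index u v : u \in S -> v \in S -> u < v ->
  exists i, tnth (in_tuple terminal_pairs) i = (u, v).
Proof.
move=> uS vS lt; have /tnthP[i ->] : (u, v) \in in_tuple terminal_pairs.
  by rewrite mem_terminal_pairs uS vS.
by exists i.
Qed.

Lemma terminal_pairP i : [/\ s i \in S, t i \in S & s i < t i].
Proof.
apply/and3P; rewrite -mem_terminal_pairs /s /t -surjective_pairing.
exact: (mem_tnth i (in_tuple terminal_pairs)).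
Qed.

Lemma set2_lt_inj (a b u v : 'I_(order G)) :
  a < b -> u < v -> [set a; b] = [set u; v] -> (a, b) = (u, v).
Proof.
move=> ab uv e.
have: a \in [set u; v] by rewrite -e set21.
have: b \in [set u; v] by rewrite -e set22.
rewrite !inE => /orP[] /eqP eb /orP[] /eqP ea; move: ab uv; rewrite ?ea ?eb ?ltnn //; lia.
Qed.

Lemma terminal_pair_inj i j : [set s i; t i] = [set s j; t j] -> i = j.
Proof.
have [_ _ lt_i] := terminal_pairP i; have [_ _ lt_j] := terminal_pairP j.
move=> /(set2_lt_inj lt_i lt_j) [es et]; apply/val_inj/eqP.
have pairs_uniq : uniq terminal_pairs.
  apply/filter_uniq/allpairs_uniq; try exact: enum_uniq.
  by move=> [a b] [a' b'] _ _ [-> ->].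
rewrite -(nth_uniq (s i, t i) (ltn_ord i) (ltn_ord j) pairs_uniq).
have := tnth_nth (s i, t i) (in_tuple terminal_pairs) i.
have := tnth_nth (s i, t i) (in_tuple terminal_pairs) j.
move=> /= <- <-; rewrite [X in X == _]surjective_pairing [X in _ == X]surjective_pairing.
by rewrite -/(s i) -/(t i) -/(s j) -/(t j) es et.
Qed.

(** A path indexed by a 2-element set may run either way, whereas a pair prescribes its start;
    reversal keeps a path shortest and covers the same vertices. *)
Lemma sgst_coverable : sgst_yes (SGSTInstance S) <-> coverable s t.
Proof.
split=> [[P /= [P_shortest P_cover]]|[P [P_shortest P_cover]]].
  have choice i : exists p, shortest_path (s i) (t i) p /\ p =i P [set s i; t i].
    have [sS tS lt] := terminal_pairP i.
    have [//|sh|sh] := P_shortest _ _ sS tS.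
    - by rewrite neq_ltn lt.
    - by exists (P [set s i; t i]).
    exists (rev (P [set s i; t i])); split; first exact: shortest_path_rev.
    exact: mem_rev.
  have [p p_sh] := fin_all_exists choice; exists p; split=> [i|x].
    by case: (p_sh i).
  have [u [v [uS vS uv xP]]] := P_cover x.
  wlog lt: u v uS vS uv xP / u < v.
    move=> IH; case: (ltngtP u v) => [lt|gt|/val_inj e]; first exact: (IH u v).
      by apply: (IH v u) gt => //; rewrite 1?eq_sym // setUC.
    by rewrite e eqxx in uv.
  have [i uvE] := terminal_pair_index uS vS lt; exists i.
  by rewrite (p_sh i).2 /s /t uvE.
(* The empty path is the default for sets that are not pairs of terminals. *)
pose Q (A : {set 'I_(order G)}) := odflt [::] (omap P [pick i | [set s i; t i] == A]).
have QE i : Q [set s i; t i] = P i.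
  rewrite /Q; case: pickP => [j /eqP/terminal_pair_inj -> //|/(_ i)].
  by rewrite eqxx.
exists Q; split=> [u v uS vS uv|x] /=.
  case: (ltngtP u v) => [lt|gt|/val_inj e]; last by rewrite e eqxx in uv.
    have [i uvE] := terminal_pair_index uS vS lt; left.
    by have := P_shortest i; rewrite -QE /s /t uvE.
  have [i uvE] := terminal_pair_index vS uS gt; right.
  by have := P_shortest i; rewrite -QE /s /t uvE setUC.
have [i xi] := P_cover x; have [sS tS lt] := terminal_pairP i.
by exists (s i), (t i); rewrite QE; split=> //; rewrite neq_ltn lt.
Qed.

Definition pairsT (l : tree) : tree :=
  tfilter (fun p => spine (Node Leaf (thd p)) <= spine (ttl p))
    (tflat (fun u => tmap (fun v => Node u v) l) l).

Lemma pairsT_enc : pairsT (enc_seq (@enc_vertex G) (enum S)) =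
  enc_seq (enc_pair (@enc_vertex G) (@enc_vertex G)) terminal_pairs.
Proof.
rewrite /pairsT /terminal_pairs !enc_seqE /tfilter; congr unl.
rewrite lst_flat unlK -map_comp.
have -> : flatten [seq lst (tmap [eta Node (enc_vertex u)]
                                 (unl [seq enc_vertex v | v <- enum S])) | u <- enum S]
  = [seq enc_pair (@enc_vertex G) (@enc_vertex G) p | p <- [seq (u, v) | u <- enum S, v <- enum S]].
  elim: (enum S) {1 3}(enum S) => [|u l IH] l' //.
  by rewrite /= map_cat IH lst_map unlK -!map_comp.
rewrite filter_map; congr map; apply: eq_filter => -[u v] /=.
by rewrite /spine /= -!/(spine _) !spine_enc_nat.
Qed.

End Terminals.

(** The pairs of terminals are formed in polynomial time and handed to the same algorithm; there are
    at most [k * k] of them, which [pad_size] has allowed for. *)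
Lemma FPT_sgst : FPT strong_geodetic_set_with_terminals.
Proof.
apply: (FPT_padded (kappa := fun t => tmap (fun=> Leaf) (ttl t))
  (A := fun t => coverT (Node (thd t) (Node (thd (ttl t)) (pairsT (ttl (ttl t))))))
  honest_pad_size).
- by apply: (PT_comp PT_coverT); rewrite /pairsT; pt.
- by pt.
- by move=> [G S] /=; rewrite enc_seqE tmap_leaf spine_unl size_map -cardE.
move=> [G S] pad pad_big; set c := (X in X <> _).
have cE : c = coverT (Node pad (Node (enc_graph G)
    (enc_seq (enc_pair (@enc_vertex G) (@enc_vertex G)) (in_tuple (terminal_pairs S))))).
  by rewrite -[X in _ = coverT (Node _ (Node _ X))]pairsT_enc.
rewrite cE; split=> [out|yes].
  exact/sgst_coverable/(coverT_sound out).
apply: coverT_complete; last exact/sgst_coverable.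
by apply: leq_trans pad_big; apply: pad_size_bound (size_terminal_pairs S).
Qed.

Theorem theorem3 :
  FPT isometric_path_cover_with_terminals /\
  FPT strong_geodetic_set_with_terminals.
Proof. exact: conj FPT_ipct FPT_sgst. Qed.
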